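(* For every integer $d\ge 2$ there exists a constant $c_d>0$ depending only on $d$ such that the following holds. Let $\varepsilon\in(0,1)$ and $n_1,\ldots,n_d\in\mathbb{N}$, and set $$r=\left\lceil \frac{c_d}{\varepsilon^2}\log\Big(2e\prod_{s=1}^{d} n_s\Big)\right\rceil\in\mathbb{N},$$ where $e$ is Euler's number. Then for every nonzero tensor $\mathcal{A}\in\mathbb{R}^{n_1\times\cdots\times n_d}$ of TT rank $(r_1,\ldots,r_{d-1})$ there exists a tensor $\mathcal{B}\in\mathbb{R}^{n_1\times\cdots\times n_d}$ all components of whose TT rank are at most $r$ such that, with $\mu_<^{(s)}=\mu_{\mathrm F,<}^{(s)}(\mathcal{A})$ and $\mu_>^{(s)}=\mu_{\mathrm F,>}^{(s)}(\mathcal{A})$ the left and right TT core coherences of $\mathcal{A}$ with respect to the Frobenius norm, $$\|\mathcal{A}-\mathcal{B}\|_{\max}\le\frac{\varepsilon}{\sqrt{n_1\cdots n_d}}\cdot\min_{t\in[d-1]}\left\{r_t\Big(\prod_{s=1}^{t}\mu_<^{(s)}\Big)^{1/2}\Big(\prod_{s=t+1}^{d}\mu_>^{(s)}\Big)^{1/2}\|\mathbf{A}^{<t>}\|_2\right\}.$$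
   Context: $\mathbb{N}$ denotes the positive integers, $[n]=\{1,\ldots,n\}$, $\|\mathcal{A}\|_{\max}$ is the maximal absolute value of the entries, and $\|\cdot\|_2$ is the spectral norm of a matrix. TT factorization: $\mathcal{A}=\mathrm{TT}(\mathcal{G}_1,\ldots,\mathcal{G}_d)$ with TT cores $\mathcal{G}_s\in\mathbb{R}^{k_{s-1}\times n_s\times k_s}$, $k_0=k_d=1$, means $\mathcal{A}(i_1,\ldots,i_d)=\mathcal{G}_1(:,i_1,:)\mathcal{G}_2(:,i_2,:)\cdots\mathcal{G}_d(:,i_d,:)$ (product of matrices $\mathcal{G}_s(:,i_s,:)\in\mathbb{R}^{k_{s-1}\times k_s}$) for all indices. The tuple $(k_1,\ldots,k_{d-1})\in\mathbb{N}^{d-1}$ is the TT rank of the factorization; the componentwise smallest TT rank among all exact TT factorizations of $\mathcal{A}$ is the TT rank of $\mathcal{A}$. Unfoldings: $\mathbf{A}^{<s>}\in\mathbb{R}^{(n_1\cdots n_s)\times(n_{s+1}\cdots n_d)}$ is the $s$th unfolding matrix of $\mathcal{A}$ (rows indexed by $(i_1,\ldots,i_s)$, columns by $(i_{s+1},\ldots,i_d)$). For a third-order tensor $\mathcal{G}\in\mathbb{R}^{p\times n\times q}$, its left unfolding $\mathbf{G}^{<}\in\mathbb{R}^{pn\times q}$ and right unfolding $\mathbf{G}^{>}\in\mathbb{R}^{p\times nq}$ are ordered so that $\mathbf{G}^{<}(\alpha+(i-1)p,\beta)=\mathcal{G}(\alpha,i,\beta)=\mathbf{G}^{>}(\alpha,\beta+(i-1)q)$.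 A TT factorization of a nonzero tensor is minimal if $\mathbf{G}_s^{<}$ and $\mathbf{G}_s^{>}$ are full-rank for every core, equivalently if its TT rank equals the TT rank of the tensor. A third-order tensor is left-orthogonal if its left unfolding has orthonormal columns and right-orthogonal if its right unfolding has orthonormal rows. A TT factorization is left-orthogonal if the cores $\mathcal{G}_1,\ldots,\mathcal{G}_{d-1}$ are left-orthogonal, and right-orthogonal if $\mathcal{G}_2,\ldots,\mathcal{G}_d$ are right-orthogonal. Block coherence: let $\mathrm{M}\subseteq\mathbb{R}^m$ be a $q$-dimensional subspace with an orthonormal basis given by the columns of $\mathbf{Q}\in\mathbb{R}^{m\times q}$, let $p$ divide $m$ and $n=m/p$. The $p$-block coherence of $\mathrm{M}$ with respect to the Frobenius norm is $$\mu_{\mathrm F,p}(\mathrm{M})=\tfrac{m}{q}\max_{i\in[n]}\big\|\mathbf{Q}^\top[\,\mathbf{e}_{1+(i-1)p}\ \mathbf{e}_{2+(i-1)p}\ \cdots\ \mathbf{e}_{p+(i-1)p}\,]\big\|_{\mathrm F}^2,$$ where $\mathbf{e}_j$ are the standard basis vectors of $\mathbb{R}^m$; it does not depend on the choice of $\mathbf{Q}$. For $\mathcal{G}\in\mathbb{R}^{p\times n\times q}$ set $\mu_{\mathrm F,<}(\mathcal{G})=\mu_{\mathrm F,p}(\mathrm{col}(\mathbf{G}^{<}))$ and $\mu_{\mathrm F,>}(\mathcal{G})=\mu_{\mathrm F,q}(\mathrm{row}(\mathbf{G}^{>}))$, where $\mathrm{col}$ and $\mathrm{row}$ are the column and row spaces.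 TT core coherences: let $\mathcal{A}$ have a minimal left-orthogonal TT factorization $\{\mathcal{U}_s\}_{s=1}^d$ and a minimal right-orthogonal TT factorization $\{\mathcal{V}_s\}_{s=1}^d$. Then $\mu_{\mathrm F,<}^{(s)}(\mathcal{A})=\mu_{\mathrm F,<}(\mathcal{U}_s)$ for $s=1,\ldots,d-1$ and $\mu_{\mathrm F,>}^{(s)}(\mathcal{A})=\mu_{\mathrm F,>}(\mathcal{V}_s)$ for $s=2,\ldots,d$; these do not depend on the choice of the factorizations. *)

(* Defs.v *)
From mathcomp Require Import all_boot all_order all_algebra.
From mathcomp Require Import boolp classical_sets reals sequences exp.

Set Implicit Arguments.
Unset Strict Implicit.
Unset Printing Implicit Defensive.

Import Order.TTheory GRing.Theory Num.Theory.

Local Open Scope ring_scope.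

(* Modes and slice indices are numbered from 0: mode s : 'I_d stands for the
   mode s + 1 of the usual 1-based numbering. *)

Definition multi_index (d : nat) (n : 'I_d -> nat) : finType :=
  {dffun forall s : 'I_d, 'I_(n s)}.

Definition tensor (R : realType) (d : nat) (n : 'I_d -> nat) : zmodType :=
  {ffun multi_index n -> R}.

Definition max_norm (R : realType) (d : nat) (n : 'I_d -> nat)
    (A : tensor R n) : R :=
  \big[Num.max/0]_(i : multi_index n) `|A i|.

Definition frobenius_norm (R : realType) (m n : nat) (M : 'M[R]_(m, n)) : R :=
  Num.sqrt (\sum_(i < m) \sum_(j < n) M i j ^+ 2).

(* On column vectors the Frobenius norm is the Euclidean norm. *)
Definition spectral_norm (R : realType) (m n : nat) (M : 'M[R]_(m, n)) : R :=
  sup [set frobenius_norm (M *m x) | x in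
        [set x : 'cV[R]_n | frobenius_norm x <= 1]]%classic.

(* The rows (columns) of the t-th unfolding are indexed by the restrictions of
   multi-indices to the modes s < t (to the modes s >= t). *)
Definition row_index (d : nat) (n : 'I_d -> nat) (t : nat) : finType :=
  {dffun forall s : {s : 'I_d | (s < t)%N}, 'I_(n (val s))}.

Definition col_index (d : nat) (n : 'I_d -> nat) (t : nat) : finType :=
  {dffun forall s : {s : 'I_d | ~~ (s < t)%N}, 'I_(n (val s))}.

Definition join_index (d : nat) (n : 'I_d -> nat) (t : nat)
    (i : row_index n t) (j : col_index n t) : multi_index n :=
  [ffun s : 'I_d =>
    match boolP (s < t)%N with
    | AltTrue lt_st => i (exist _ s lt_st)
    | AltFalse ge_st => j (exist _ s ge_st)
    end].

Definition unfolding (R : realType) (d : nat) (n : 'I_d -> nat) (t : nat)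
    (A : tensor R n) : 'M[R]_(#|row_index n t|, #|col_index n t|) :=
  \matrix_(a, b) A (join_index (enum_val a) (enum_val b)).

(* A third-order tensor G in R^(p x n x q), given by its slices G(:, i, :). *)
Definition core3 (R : realType) (p n q : nat) : Type := 'I_n -> 'M[R]_(p, q).

(* mxvec is row-major: entry (i, a) of an n x p matrix goes to position
   i * p + a. *)
Definition left_unfolding (R : realType) (p n q : nat) (G : core3 R p n q) :
    'M[R]_(n * p, q) :=
  \matrix_(k, b) mxvec (\matrix_(i < n, a < p) G i a b) 0 k.

Definition right_unfolding (R : realType) (p n q : nat) (G : core3 R p n q) :
    'M[R]_(p, n * q) :=
  \matrix_(a, k) mxvec (\matrix_(i < n, b < q) G i a b) 0 k.

Definition left_orthogonal (R : realType) (p n q : nat) (G : core3 R p n q) :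
    Prop :=
  (left_unfolding G)^T *m left_unfolding G = 1%:M.

Definition right_orthogonal (R : realType) (p n q : nat) (G : core3 R p n q) :
    Prop :=
  right_unfolding G *m (right_unfolding G)^T = 1%:M.

(* Only the values rk 0, ..., rk d are meaningful. *)
Record tt_fact (R : realType) (d : nat) (n : 'I_d -> nat) := TTFact {
  rk : nat -> nat;
  core : forall s : 'I_d, core3 R (rk s) (n s) (rk s.+1);
  rk_first : rk 0 = 1%N;
  rk_last : rk d = 1%N;
  rk_gt0 : forall s, (s <= d)%N -> (0 < rk s)%N
}.

Arguments core {R d n} t s _.

(* The product of the first m slices selected by i. *)
Fixpoint tt_prod (R : realType) (d : nat) (n : 'I_d -> nat) (U : tt_fact R n)
    (i : multi_index n) (m : nat) : (m <= d)%N -> 'M[R]_(rk U 0, rk U m) :=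
  match m return (m <= d)%N -> 'M[R]_(rk U 0, rk U m) with
  | 0 => fun _ => 1%:M
  | m'.+1 => fun lt_m'd =>
      tt_prod U i (ltnW lt_m'd) *m
      core U (Ordinal lt_m'd) (i (Ordinal lt_m'd))
  end.

Definition TT (R : realType) (d : nat) (n : 'I_d -> nat) (U : tt_fact R n) :
    tensor R n :=
  [ffun i => castmx (rk_first U, rk_last U) (tt_prod U i (leqnn d)) 0 0].

Definition is_tt_rank (R : realType) (d : nat) (n : 'I_d -> nat)
    (A : tensor R n) (r : nat -> nat) : Prop :=
  (exists2 U : tt_fact R n,
     TT U = A & forall s, (0 < s < d)%N -> rk U s = r s) /\
  (forall U : tt_fact R n,
     TT U = A -> forall s, (0 < s < d)%N -> (r s <= rk U s)%N).

(* Full rank means full column rank for the left unfoldings and full row rank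
   for the right ones; this is what makes minimality equivalent to having the
   TT rank of the tensor. *)
Definition minimal_tt (R : realType) (d : nat) (n : 'I_d -> nat)
    (U : tt_fact R n) : Prop :=
  forall s : 'I_d, row_full (left_unfolding (core U s)) /\
                   row_free (right_unfolding (core U s)).

Definition left_orthogonal_tt (R : realType) (d : nat) (n : 'I_d -> nat)
    (U : tt_fact R n) : Prop :=
  forall s : 'I_d, (s.+1 < d)%N -> left_orthogonal (core U s).

Definition right_orthogonal_tt (R : realType) (d : nat) (n : 'I_d -> nat)
    (U : tt_fact R n) : Prop :=
  forall s : 'I_d, (0 < s)%N -> right_orthogonal (core U s).

(* Subspaces of R^m are row spaces of matrices with m columns. *)
Definition orthonormal_basis (R : realType) (k m : nat) (M : 'M[R]_(k, m)) :
    'M[R]_(m, \rank M) :=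
  xget 0 [set Q : 'M[R]_(m, \rank M) |
           Q^T *m Q = 1%:M /\ (Q^T == M)%MS]%classic.

(* The columns are the standard basis vectors of the i-th block of length p. *)
Definition block_cols (R : realType) (n p : nat) (i : 'I_n) :
    'M[R]_(n * p, p) :=
  \matrix_(k, a) (k == mxvec_index i a)%:R.

(* The p-block coherence of the row space of M, the ambient space being
   R^(n * p). *)
Definition block_coherence (R : realType) (k n p : nat)
    (M : 'M[R]_(k, n * p)) : R :=
  (n * p)%:R / (\rank M)%:R *
  \big[Num.max/0]_(i < n)
    frobenius_norm ((orthonormal_basis M)^T *m block_cols R p i) ^+ 2.

Definition left_coherence (R : realType) (p n q : nat) (G : core3 R p n q) : R :=
  block_coherence (left_unfolding G)^T.

Definition right_coherence (R : realType) (p n q : nat) (G : core3 R p n q) : R :=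
  block_coherence (right_unfolding G).

(* The left (right) core coherences are only meaningful for all modes but the
   last (but the first). *)
Definition left_core_coherence (R : realType) (d : nat) (n : 'I_d -> nat)
    (A : tensor R n) : {ffun 'I_d -> R} :=
  xget 0 [set mu : {ffun 'I_d -> R} |
    exists U : tt_fact R n, [/\ TT U = A, minimal_tt U, left_orthogonal_tt U &
      mu = [ffun s => left_coherence (core U s)]]]%classic.

Definition right_core_coherence (R : realType) (d : nat) (n : 'I_d -> nat)
    (A : tensor R n) : {ffun 'I_d -> R} :=
  xget 0 [set mu : {ffun 'I_d -> R} |
    exists V : tt_fact R n, [/\ TT V = A, minimal_tt V, right_orthogonal_tt V &
      mu = [ffun s => right_coherence (core V s)]]]%classic.

(* The quantity minimised over t, for a tensor A of TT rank k. *)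
Definition tt_bound (R : realType) (d : nat) (n : 'I_d -> nat)
    (A : tensor R n) (k : nat -> nat) (t : nat) : R :=
  (k t)%:R *
  Num.sqrt (\prod_(s < d | (s < t)%N) left_core_coherence A s) *
  Num.sqrt (\prod_(s < d | (t <= s)%N) right_core_coherence A s) *
  spectral_norm (unfolding t A).

(* Main.v *)
(* A product of core coherences is, up to the mode sizes and the TT rank, the
   product of the largest squared Frobenius norms of the slices of orthogonal
   cores. With U left-orthogonal and V right-orthogonal, A(i) equals
   U_1(i_1) ... U_t(i_t) S V_(t+1)(i_(t+1)) ... V_d(i_d), where S is a compression
   of the t-th unfolding, so the bound for t dominates
   sqrt (n_1 ... n_d) times the product of the Frobenius norms of the slices of
   this mixed factorization. It remains to lower the ranks of an arbitrary
   factorization G with an entrywise error of at most eps times that product. Insert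
   P^T P, with P a scaled random sign matrix, at one bond after the other: by
   the Johnson-Lindenstrauss argument one P with r rows distorts the inner
   product of the left and right partial products of every multi-index (whence
   the logarithm of n_1 ... n_d) by at most delta times the product of the core
   norms, and at most doubles the latter, so that delta = eps / 2^d suffices. *)

Require Import Defs.
From mathcomp Require Import all_boot all_order all_algebra.
From mathcomp Require Import boolp classical_sets reals sequences exp.
From mathcomp Require Import ring lra zify.

Set Implicit Arguments.
Unset Strict Implicit.
Unset Printing Implicit Defensive.

Import Order.TTheory GRing.Theory Num.Theory.

Local Open Scope ring_scope.

(** * Random embeddings *)

(** The error at a bond is governed by the norms of the two partial products meeting there, and
    these change with every earlier insertion. Submultiplicativity bounds them by a product of slice
    norms, in which an insertion touches only the two neighbouring factors. Hence P has to control
    the slices on both sides of the bond besides the inner products, and the union bound runs over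
    four matrices per multi-index. Random signs on a finite sample space turn every probability into
    a count.

    The factor r_t of the bound arises because the ranks inside the left coherences telescope to
    1/r_t, and likewise on the right: each square root contributes one sqrt r_t.

    The coherences are picked by choice among minimal orthogonal factorizations, so existence of
    such a factorization has to be proved before the coherences mean anything. It comes from
    minimising the sum of all ranks and then sweeping with invertible gauge changes. The same
    minimal factorizations identify the TT rank with the ranks of the unfoldings, which also
    provides a TT rank for B. *)

Lemma sum_cauchy_schwarz (R : realType) (I : finType) (a b : I -> R) :
  (\sum_i a i * b i) ^+ 2 <= (\sum_i a i ^+ 2) * (\sum_i b i ^+ 2).
Proof.
suff : 0 <= \sum_i \sum_j (a i * b j - a j * b i) ^+ 2.
  have -> : \sum_i \sum_j (a i * b j - a j * b i) ^+ 2 =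
      2 * ((\sum_i a i ^+ 2) * (\sum_i b i ^+ 2) - (\sum_i a i * b i) ^+ 2).
    have E i j : (a i * b j - a j * b i) ^+ 2 =
        a i ^+ 2 * b j ^+ 2 + b i ^+ 2 * a j ^+ 2
        - 2 * (a i * b i) * (a j * b j) by ring.
    under eq_bigr do under eq_bigr do rewrite E.
    under eq_bigr do rewrite sumrB big_split /= -!mulr_sumr.
    rewrite sumrB big_split /= -!mulr_suml -mulr_sumr.
    ring.
  by rewrite pmulr_rge0 // subr_ge0.
by apply: sumr_ge0 => i _; apply: sumr_ge0 => j _; exact: sqr_ge0.
Qed.

Definition sqfrob (R : realType) (m n : nat) (M : 'M[R]_(m, n)) : R :=
  \sum_i \sum_j M i j ^+ 2.

Lemma sqfrob_ge0 (R : realType) (m n : nat) (M : 'M[R]_(m, n)) : 0 <= sqfrob M.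
Proof. by apply: sumr_ge0 => i _; apply: sumr_ge0 => j _; exact: sqr_ge0. Qed.

Lemma frobenius_ge0 (R : realType) (m n : nat) (M : 'M[R]_(m, n)) :
  0 <= frobenius_norm M.
Proof. exact: sqrtr_ge0. Qed.

Lemma sqr_frobenius (R : realType) (m n : nat) (M : 'M[R]_(m, n)) :
  frobenius_norm M ^+ 2 = sqfrob M.
Proof. by rewrite sqr_sqrtr ?sqfrob_ge0. Qed.

Lemma sqfrob_eq0 (R : realType) (m n : nat) (M : 'M[R]_(m, n)) :
  (sqfrob M == 0) = (M == 0).
Proof.
apply/idP/eqP => [|->]; last first.
  by apply/eqP; rewrite /sqfrob; do 2![rewrite big1 // => ? _]; rewrite mxE expr0n.
rewrite psumr_eq0; last by move=> i _; apply: sumr_ge0 => j _; exact: sqr_ge0.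
move/allP => h; apply/matrixP => i j.
have := h i (mem_index_enum i).
rewrite psumr_eq0 /=; last by move=> ? _; exact: sqr_ge0.
by move/allP/(_ j (mem_index_enum j)); rewrite mxE sqrf_eq0 => /eqP.
Qed.

Lemma sqfrob0 (R : realType) (m n : nat) : sqfrob (0 : 'M[R]_(m, n)) = 0.
Proof. by apply/eqP; rewrite sqfrob_eq0. Qed.

Lemma sqfrob_tr (R : realType) (m n : nat) (M : 'M[R]_(m, n)) :
  sqfrob M^T = sqfrob M.
Proof.
rewrite /sqfrob exchange_big /=.
by apply: eq_bigr => i _; apply: eq_bigr => j _; rewrite mxE.
Qed.

Lemma sqfrobZ (R : realType) (m n : nat) (a : R) (M : 'M[R]_(m, n)) :
  sqfrob (a *: M) = a ^+ 2 * sqfrob M.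
Proof.
rewrite /sqfrob mulr_sumr; apply: eq_bigr => i _.
by rewrite mulr_sumr; apply: eq_bigr => j _; rewrite mxE exprMn.
Qed.

Lemma sqfrob_row (R : realType) (m n : nat) (M : 'M[R]_(m, n)) :
  sqfrob M = \sum_i sqfrob (row i M).
Proof.
apply: eq_bigr => i _; rewrite /sqfrob big_ord1.
by apply: eq_bigr => j _; rewrite mxE.
Qed.

Lemma sqfrobE (R : realType) (m n : nat) (M : 'M[R]_(m, n)) :
  sqfrob M = \tr (M *m M^T).
Proof.
apply: eq_bigr => i _; rewrite !mxE.
by apply: eq_bigr => j _; rewrite !mxE expr2.
Qed.

Lemma sqfrob_mul_le (R : realType) (m n p : nat) (M : 'M[R]_(m, n))
    (N : 'M[R]_(n, p)) : sqfrob (M *m N) <= sqfrob M * sqfrob N.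
Proof.
rewrite -(sqfrob_tr N) /sqfrob mulr_suml; apply: ler_sum => i _.
rewrite mulr_sumr; apply: ler_sum => j _; rewrite !mxE.
apply: le_trans (sum_cauchy_schwarz _ _) _.
rewrite le_eqVlt; apply/orP; left; apply/eqP; congr (_ * _).
by apply: eq_bigr => k _; rewrite mxE.
Qed.

Lemma frobenius_tr (R : realType) (m n : nat) (M : 'M[R]_(m, n)) :
  frobenius_norm M^T = frobenius_norm M.
Proof. by rewrite /frobenius_norm -/(sqfrob _) sqfrob_tr. Qed.

Lemma frobenius_mul_le (R : realType) (m n p : nat) (M : 'M[R]_(m, n))
    (N : 'M[R]_(n, p)) :
  frobenius_norm (M *m N) <= frobenius_norm M * frobenius_norm N.
Proof.
by rewrite /frobenius_norm -sqrtrM ?sqfrob_ge0// ler_sqrt ?sqfrob_mul_le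
  ?mulr_ge0 ?sqfrob_ge0.
Qed.

(** The sharp exponent is y^2 / 2; the weaker 2 y^2 follows from 1 + x <= exp x alone. For |y| > 1/2
    it already dominates |y|, and for smaller |y| rational bounds on both exponentials suffice. *)
Lemma cosh_le_expR (R : realType) (y : R) :
  expR y + expR (- y) <= 2 * expR (2 * y ^+ 2).
Proof.
have key (z : R) : 0 <= z -> expR z + expR (- z) <= 2 * expR (2 * z ^+ 2).
  move=> z0; have [hz|hz] := leP z (1 / 2); last first.
    have h1 : expR z <= expR (2 * z ^+ 2) by rewrite ler_expR; nra.
    have h2 : expR (- z) <= expR (2 * z ^+ 2) by rewrite ler_expR; nra.
    lra.
  have e2 : 1 + 2 * z ^+ 2 <= expR (2 * z ^+ 2) by exact: expR_ge1Dx.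
  (* bound exp z and exp (- z) by (1 - z / 2)^-2 and (1 + z / 2)^-2 *)
  have h1 : expR z * (1 - z / 2) ^+ 2 <= 1.
    have -> : expR z = (expR (z / 2)) ^+ 2 by rewrite -expRM_natl; congr expR; lra.
    rewrite -exprMn; apply: exprn_ile1.
      by rewrite mulr_ge0 ?expR_ge0//; lra.
    have := expR_ge1Dx (- (z / 2)); rewrite expRN => h.
    have h0 : 0 < expR (z / 2) := expR_gt0 _.
    by rewrite mulrC -ler_pdivlMr // div1r.
  have h2 : expR (- z) * (1 + z / 2) ^+ 2 <= 1.
    have -> : expR (- z) = (expR (- (z / 2))) ^+ 2.
      by rewrite -expRM_natl; congr expR; lra.
    rewrite -exprMn; apply: exprn_ile1.
      by rewrite mulr_ge0 ?expR_ge0//; lra.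
    have := expR_ge1Dx (z / 2) => h.
    have h0 : 0 < expR (z / 2) := expR_gt0 _.
    by rewrite expRN mulrC ler_pdivrMr // mul1r.
  have p0 : 0 < expR z := expR_gt0 _.
  have p1 : 0 < expR (- z) := expR_gt0 _.
  have b1 : expR z <= ((1 - z / 2) ^+ 2)^-1.
    by rewrite -[leRHS]div1r ler_pdivlMr //; nra.
  have b2 : expR (- z) <= ((1 + z / 2) ^+ 2)^-1.
    by rewrite -[leRHS]div1r ler_pdivlMr //; nra.
  apply: (le_trans (lerD b1 b2)); apply: (@le_trans _ _ (2 * (1 + 2 * z ^+ 2))).
    have q1 : 1 - z / 2 != 0 by rewrite gt_eqF//; lra.
    have q2 : 1 + z / 2 != 0 by rewrite gt_eqF//; lra.
    have -> : ((1 - z / 2) ^+ 2)^-1 + ((1 + z / 2) ^+ 2)^-1 =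
        (2 + z ^+ 2 / 2) / (1 - z ^+ 2 / 4) ^+ 2.
      have q3 : 1 - z ^+ 2 / 4 != 0 by rewrite gt_eqF//; nra.
      by field; rewrite !lt0r_neq0 //; nra.
    rewrite ler_pdivrMr; last by nra.
    set w := z ^+ 2; have w0 : 0 <= w := sqr_ge0 _.
    have w1 : w <= 1 / 4 by rewrite /w; nra.
    nra.
  lra.
case: (leP 0 y) => hy; first exact: key.
by have := key (- y); rewrite opprK sqrrN addrC; apply; lra.
Qed.

Lemma sqfrobD_row (R : realType) (q : nat) (u v : 'rV[R]_q) :
  sqfrob (u + v) = sqfrob u + 2 * (\sum_j u 0 j * v 0 j) + sqfrob v.
Proof.
rewrite /sqfrob !big_ord1 mulr_sumr -!big_split /=.
by apply: eq_bigr => j _; rewrite mxE; ring.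
Qed.

(** The two squared norms differ only in the sign of the cross term 2 s, so their average is a
    hyperbolic cosine of 2 a s. Its bound exp (8 a^2 s^2) and Cauchy-Schwarz for s shift the
    coefficient of [sqfrob v] from a to a + 8 a^2 [sqfrob u]. *)
Lemma expR_sign_avg (R : realType) (q : nat) (a : R) (u v : 'rV[R]_q) :
  expR (a * sqfrob (u + v)) + expR (a * sqfrob (- u + v)) <=
  2 * expR (a * sqfrob u) *
    expR ((a + 8 * a ^+ 2 * sqfrob u) * sqfrob v).
Proof.
have Nu : sqfrob (- u) = sqfrob u by rewrite -scaleN1r sqfrobZ sqrrN expr1n mul1r.
rewrite !sqfrobD_row Nu; set s := \sum_j u 0 j * v 0 j.
have -> : \sum_j (- u) 0 j * v 0 j = - s.
  by rewrite -sumrN; apply: eq_bigr => j _; rewrite mxE mulNr.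
have cs : s ^+ 2 <= sqfrob u * sqfrob v.
  by rewrite /sqfrob !big_ord1; exact: sum_cauchy_schwarz.
have -> : a * (sqfrob u + 2 * s + sqfrob v) =
  a * sqfrob u + a * sqfrob v + 2 * a * s by ring.
have -> : a * (sqfrob u + 2 * - s + sqfrob v) =
  a * sqfrob u + a * sqfrob v - 2 * a * s by ring.
rewrite !expRD -mulrDr.
have -> : (a + 8 * a ^+ 2 * sqfrob u) * sqfrob v =
  a * sqfrob v + 8 * a ^+ 2 * (sqfrob u * sqfrob v) by ring.
rewrite expRD -mulrA -[leRHS]mulrA [leRHS]mulrCA.
rewrite ler_pM2l ?expR_gt0// mulrCA ler_pM2l ?expR_gt0//.
apply: le_trans (cosh_le_expR _) _.
rewrite ler_pM2l// ler_expR.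
have := sqr_ge0 a; nra.
Qed.

(* g is uniformly distributed on the sign vectors, which are built one sign at a
   time: averaging over a sign turns the cross term into a hyperbolic cosine. *)
Lemma rademacher_row (R : realType) (k : nat) :
  exists (W : finType) (g : W -> 'rV[R]_k), (0 < #|W|)%N /\
    forall q (M : 'M[R]_(k, q)) (a : R), `|a| * sqfrob M <= 1 / 32 ->
      \sum_w expR (a * sqfrob (g w *m M)) <=
      #|W|%:R * expR (a * sqfrob M + 8 * (a * sqfrob M) ^+ 2).
Proof.
elim: k => [|k [W [g [W0 IH]]]].
  exists unit, (fun=> 0); split=> [|q M a _]; first by rewrite card_unit.
  have -> : sqfrob M = 0 by rewrite /sqfrob big_ord0.
  rewrite big_const card_unit /= addr0 mulr0 expr0n /= mulr0 addr0.
  by rewrite mul0mx sqfrob0 mulr0 expR0 mulr1.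
exists (bool * W)%type.
exists (fun w : bool * W => row_mx ((-1) ^+ w.1)%:M (g w.2) : 'rV_(1 + k)).
split=> [|q]; first by rewrite card_prod card_bool muln_gt0.
change k.+1 with (1 + k)%N => M a ha.
rewrite -[M in leLHS]vsubmxK; set m := usubmx M; set M' := dsubmx M.
have EM : sqfrob M = sqfrob m + sqfrob M'.
  rewrite /sqfrob big_split_ord /=; congr (_ + _).
    by apply: eq_bigr => i _; apply: eq_bigr => j _; rewrite mxE.
  by apply: eq_bigr => i _; apply: eq_bigr => j _; rewrite mxE.
have m0 := sqfrob_ge0 m; have M'0 := sqfrob_ge0 M'.
have : - `|a| <= a by rewrite lerNnormlW.
have := ler_norm a.
move: ha; rewrite EM; set x := sqfrob m; set y := sqfrob M'.
move=> ha la1 la2.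
have xy0 : 0 <= x + y by rewrite addr_ge0.
have ax : a * x + a * y <= 1 / 32.
  by rewrite -mulrDr; apply: le_trans ha; exact: ler_wpM2r.
have ax' : - (1 / 32) <= a * x + a * y.
  rewrite -mulrDr lerNl -mulNr; apply: le_trans ha; apply: ler_wpM2r => //.
  by rewrite lerNl.
rewrite -(pair_bigA _ (fun (b : bool) (w : W) => expR (a * sqfrob
  (row_mx ((-1) ^+ b)%:M (g w) *m col_mx m M')))) /=.
rewrite exchange_big /=.
(* Once the first sign is averaged out, the remaining rows see the exponent [a']. The budget 1/32
   survives: a x and a y have the same sign, so the correction 8 (a x) (a y) is at most |a x| / 4 in
   absolute value. *)
set a' := a + 8 * a ^+ 2 * x.
apply: (@le_trans _ _ (\sum_w 2 * expR (a * x) * expR (a' * sqfrob (g w *m M')))).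
  apply: ler_sum => w _; rewrite big_bool /= addrC.
  rewrite !mul_row_col !mul_scalar_mx expr0 expr1 scale1r scaleN1r.
  exact: expR_sign_avg.
rewrite -mulr_sumr.
have a'y : a' * y = a * y + 8 * (a * x) * (a * y) by rewrite /a'; ring.
have a'h : `|a'| * y <= 1 / 32.
  have <- : `|a' * y| = `|a'| * y by rewrite normrM (ger0_norm M'0).
  rewrite a'y ler_norml.
  have : 0 <= a * x /\ 0 <= a * y \/ a * x <= 0 /\ a * y <= 0.
    have [a0|a0] := leP 0 a; [left|right].
      by split; exact: mulr_ge0.
    by split; rewrite mulr_le0_ge0// ltW.
  move: (a * x) (a * y) ax ax' => s t hs hs' [[s0 t0]|[s0 t0]].
    have h : 0 <= s * t by rewrite mulr_ge0.
    have : s * t <= s * (1 / 32) by rewrite ler_wpM2l//; lra.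
    by move=> *; apply/andP; split; lra.
  have h : 0 <= s * t by rewrite mulr_le0.
  have : s * t <= s * - (1 / 32) by rewrite ler_wnM2l//; lra.
  by move=> *; apply/andP; split; lra.
apply: (@le_trans _ _ (2 * expR (a * x) *
    (#|W|%:R * expR (a' * y + 8 * (a' * y) ^+ 2)))).
  by apply: ler_wpM2l (IH _ _ _ a'h); rewrite mulr_ge0// expR_ge0.
rewrite card_prod card_bool natrM.
rewrite -!mulrA ler_pM2l// mulrCA ler_wpM2l// -expRD ler_expR.
rewrite a'y mulrDr.
have : 0 <= (a * x) * (a * y).
  by rewrite mulrACA; apply: mulr_ge0; [exact: sqr_ge0|exact: mulr_ge0].
have : `|a * x| <= 1 / 32 /\ `|a * y| <= 1 / 32.
  rewrite !normrM (ger0_norm m0) (ger0_norm M'0) -/x -/y.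
  have hx : 0 <= `|a| * x by exact: mulr_ge0.
  have hy : 0 <= `|a| * y by exact: mulr_ge0.
  by move: ha; rewrite mulrDr; split; lra.
rewrite !ler_norml => -[/andP[x1 x2] /andP[y1 y2]].
move: (a * x) (a * y) ax ax' x1 x2 y1 y2 => s t *.
(* Expanding 8 (s + t)^2 leaves room for 8 s^2 + 8 s t; [h1] and [h2] bound the higher terms 128 t
   (s t) and 512 s^2 t^2 by 4 s t and s^2 / 2. *)
have h1 : 0 <= (1 / 32 - t) * (s * t) by apply: mulr_ge0 => //; lra.
have h2 : 0 <= s ^+ 2 * ((1 / 32 - t) * (1 / 32 + t)).
  by rewrite mulr_ge0 ?sqr_ge0 ?mulr_ge0//; lra.
have h3 := sqr_ge0 s.
rewrite [leLHS](_ : _ = s + t + 8 * (s * t) + 8 * t ^+ 2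
  + 128 * (t * (s * t)) + 512 * (s ^+ 2 * t ^+ 2)); last by ring.
rewrite [leRHS](_ : _ = s + t + 8 * s ^+ 2 + 16 * (s * t) + 8 * t ^+ 2);
  last by ring.
nra.
Qed.

(** Independence of the rows: the exponential moment of a matrix of r rows is the r-th power of that
    of one row. *)
Lemma expR_sum_rows (R : realType) (W : finType) (k q r : nat)
    (g : W -> 'rV[R]_k) (M : 'M[R]_(k, q)) (a : R) :
  \sum_(w : {ffun 'I_r -> W}) expR (a * sqfrob ((\matrix_l g (w l)) *m M)) =
  (\sum_w expR (a * sqfrob (g w *m M))) ^+ r.
Proof.
rewrite -[r in RHS]card_ord -prodr_const.
rewrite (bigA_distr_bigA (fun (l : 'I_r) w => expR (a * sqfrob (g w *m M)))) /=.
apply: eq_bigr => w _; rewrite sqfrob_row mulr_sumr expR_sum.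
by apply: eq_bigr => l _; rewrite row_mul rowK.
Qed.

Lemma johnson_lindenstrauss (R : realType) (I : finType) (k r : nat)
    (q : I -> nat) (M : forall i, 'M[R]_(k, q i)) (delta : R) :
  (0 < r)%N -> 0 < delta <= 1 / 2 ->
  2 * #|I|%:R * expR (- (r%:R * delta ^+ 2 / 32)) < 1 ->
  exists P : 'M[R]_(r, k), forall i,
    `|sqfrob (P *m M i) - sqfrob (M i)| <= delta * sqfrob (M i).
Proof.
move=> r0 /andP[d0 d1] small.
have [W [g [W0 mgf]]] := rademacher_row R k.
pose G (w : {ffun 'I_r -> W}) : 'M[R]_(r, k) := \matrix_l g (w l).
have rR : 0 < r%:R :> R by rewrite ltr0n.
have WR : 0 < #|W|%:R :> R by rewrite ltr0n.
(* the Chernoff weight of the event that [i] is distorted in the direction [s] *)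
pose dev (s : bool) w i := let a := (-1) ^+ s * delta / 16 / sqfrob (M i) in
  expR (a * (sqfrob (G w *m M i) - r%:R * (sqfrob (M i) +
    (-1) ^+ s * delta * sqfrob (M i)))).
(* With x = |a F| the exponent per row is 8 x^2 - delta x, smallest at x = delta / 16 with value -
   delta^2 / 32. The moment bound needs x <= 1/32, that is delta <= 1/2. *)
have dev_le (s : bool) i : sqfrob (M i) != 0 -> \sum_w dev s w i <=
    (#|W| ^ r)%:R * expR (- (r%:R * delta ^+ 2 / 32)).
  move=> Fi; rewrite /dev; set a := _ / sqfrob _; set F := sqfrob (M i) in Fi a *.
  have aF : a * F = (-1) ^+ s * delta / 16 by rewrite /a mulfVK.
  under eq_bigr do rewrite mulrBr expRD.
  rewrite -mulr_suml expR_sum_rows.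
  apply: (@le_trans _ _ ((#|W|%:R * expR (a * F + 8 * (a * F) ^+ 2)) ^+ r *
     expR (- (a * (r%:R * (F + (-1) ^+ s * delta * F)))))).
    rewrite ler_wpM2r ?expR_ge0// lerXn2r ?nnegrE ?sumr_ge0//.
    - by move=> ? _; exact: expR_ge0.
    - by rewrite mulr_ge0 ?expR_ge0// ltW.
    apply: mgf; rewrite -[in leLHS](ger0_norm (sqfrob_ge0 (M i))) -normrM aF.
    by rewrite !normrM normrX normrN1 expr1n mul1r !ger0_norm; lra.
  rewrite exprMn -natrX -expRM_natl -[leLHS]mulrA -expRD.
  rewrite ler_wpM2l ?ler0n// ler_expR.
  have -> : a * (r%:R * (F + (-1) ^+ s * delta * F)) =
    r%:R * (a * F + (-1) ^+ s * delta * (a * F)) by ring.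
  rewrite aF.
  have s2 : ((-1) ^+ s) ^+ 2 = 1 :> R by rewrite sqrr_sign.
  rewrite le_eqVlt; apply/orP; left; apply/eqP.
  case: s {a aF s2 dev}; rewrite /= ?expr0 ?expr1; lra.
have [|bad] := pselect (exists w, \sum_(i | sqfrob (M i) != 0)
    (dev true w i + dev false w i) < 1); last first.
  have : (#|W| ^ r)%:R <= \sum_w \sum_(i | sqfrob (M i) != 0)
      (dev true w i + dev false w i).
    have -> : (#|W| ^ r)%:R = \sum_(w : {ffun 'I_r -> W}) 1 :> R.
      by rewrite sumr_const card_ffun card_ord.
    apply: ler_sum => w _.
    by rewrite leNgt; apply/negP => h; apply: bad; exists w.
  rewrite leNgt => /negP[]; rewrite exchange_big /=.
  apply: (@le_lt_trans _ _ (\sum_(i : I) 2 * ((#|W| ^ r)%:R *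
      expR (- (r%:R * delta ^+ 2 / 32))))).
    apply: (@le_trans _ _ (\sum_(i | sqfrob (M i) != 0) 2 * ((#|W| ^ r)%:R *
      expR (- (r%:R * delta ^+ 2 / 32))))).
      apply: ler_sum => i Fi; rewrite big_split /=.
      move: (dev_le true i Fi) (dev_le false i Fi).
      by move: (_ * expR _) => C; lra.
    rewrite [leRHS](bigID (fun i => sqfrob (M i) != 0)) /= lerDl.
    by apply: sumr_ge0 => i _; rewrite !mulr_ge0 ?ler0n ?expR_ge0.
  rewrite sumr_const -mulr_natl.
  have W1 : 0 < (#|W| ^ r)%:R :> R by rewrite ltr0n expn_gt0 W0.
  rewrite [ltLHS](_ : _ = (#|W| ^ r)%:R *
    (2 * #|I|%:R * expR (- (r%:R * delta ^+ 2 / 32)))); last by ring.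
  by rewrite gtr_pMr.
(* The deviations are centred at [r] times [sqfrob (M i)], whence the scaling by 1 / sqrt r. A
   weight below 1 has a negative exponent, which is the one-sided distortion bound. *)
move=> [w hw]; exists ((Num.sqrt r%:R)^-1 *: G w) => i.
rewrite -scalemxAl sqfrobZ exprVn sqr_sqrtr ?ler0n//.
have [/eqP Fi|Fi] := eqVneq (sqfrob (M i)) 0.
  move: (Fi); rewrite sqfrob_eq0 => /eqP ->.
  by rewrite mulmx0 !sqfrob0 !mulr0 subr0 normr0.
have Fi0 : 0 < sqfrob (M i) by rewrite lt_neqAle eq_sym Fi sqfrob_ge0.
have dev1 s : dev s w i < 1.
  apply: le_lt_trans hw; rewrite (bigD1 i) //=.
  have h0 s' j : 0 <= dev s' w j := expR_ge0 _.
  have : 0 <= \sum_(j | (sqfrob (M j) != 0) && (j != i))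
    (dev true w j + dev false w j) by apply: sumr_ge0 => j _; rewrite addr_ge0.
  move: (h0 true i) (h0 false i); move: (\sum_(j | _) _) => S.
  case: s; move: (dev true w i) (dev false w i) => a b; lra.
have pos : 0 < delta / 16 / sqfrob (M i) by rewrite !divr_gt0.
have := dev1 true; have := dev1 false; rewrite /dev /= expr0 expr1 !expR_lt1.
rewrite !mul1r pmulr_rlt0// !mulN1r !mulNr oppr_lt0 pmulr_rgt0//.
rewrite subr_lt0 subr_gt0 => u l.
by rewrite ler_distl [_^-1 * _]mulrC ler_pdivrMr// ler_pdivlMr//; lra.
Qed.

Lemma sqfrobD_col (R : realType) (m : nat) (u v : 'cV[R]_m) :
  sqfrob (u + v) = sqfrob u + 2 * (u^T *m v) 0 0 + sqfrob v.
Proof.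
rewrite /sqfrob !mxE mulr_sumr -!big_split /=.
by apply: eq_bigr => j _; rewrite !big_ord1 !mxE; ring.
Qed.

Lemma polarization (R : realType) (m : nat) (u v : 'cV[R]_m) :
  4 * (u^T *m v) 0 0 = sqfrob (u + v) - sqfrob (u - v).
Proof.
have Nv : sqfrob (- v) = sqfrob v by rewrite -scaleN1r sqfrobZ sqrrN expr1n mul1r.
have Ndot : (u^T *m - v) 0 0 = - (u^T *m v) 0 0 by rewrite mulmxN !mxE.
by rewrite !sqfrobD_col Nv Ndot; ring.
Qed.

(** Polarization applied to unit vectors: the squared norms of u + v and u - v sum to 4, so the
    errors add up to 4 delta. Normalising first makes the error proportional to the product of the
    norms of x and y rather than to the sum of their squares. *)
Lemma dot_distortion (R : realType) (k r : nat) (P : 'M[R]_(r, k))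
    (x y : 'cV[R]_k) (delta : R) :
  let u := (frobenius_norm x)^-1 *: x in
  let v := (frobenius_norm y)^-1 *: y in
  `|sqfrob (P *m (u + v)) - sqfrob (u + v)| <= delta * sqfrob (u + v) ->
  `|sqfrob (P *m (u - v)) - sqfrob (u - v)| <= delta * sqfrob (u - v) ->
  `|(x^T *m (P^T *m P) *m y) 0 0 - (x^T *m y) 0 0| <=
    delta * (frobenius_norm x * frobenius_norm y).
Proof.
move=> u v hp hm; have [->|x0] := eqVneq x 0.
  by rewrite trmx0 !mul0mx subrr normr0 /frobenius_norm -/(sqfrob _) sqfrob0
    sqrtr0 mul0r mulr0.
have [->|y0] := eqVneq y 0.
  by rewrite !mulmx0 subrr normr0 /frobenius_norm -/(sqfrob (0 : 'M_(k, 1)))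
    sqfrob0 sqrtr0 !mulr0.
have unit (z : 'cV[R]_k) : z != 0 ->
    0 < frobenius_norm z /\ sqfrob ((frobenius_norm z)^-1 *: z) = 1.
  move=> z0; have Fz : frobenius_norm z != 0.
    by rewrite -sqrf_eq0 sqr_frobenius sqfrob_eq0.
  split; first by rewrite lt_neqAle eq_sym Fz frobenius_ge0.
  by rewrite sqfrobZ -sqr_frobenius exprVn mulVf// sqrf_eq0.
have [nx Fu] := unit _ x0; have [ny Fv] := unit _ y0.
have Ex : x = frobenius_norm x *: u by rewrite scalerA mulfV ?scale1r// gt_eqF.
have Ey : y = frobenius_norm y *: v by rewrite scalerA mulfV ?scale1r// gt_eqF.
have Nv : sqfrob (- v) = sqfrob v by rewrite -scaleN1r sqfrobZ sqrrN expr1n mul1r.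
have bilin (E : 'M[R]_k) : (x^T *m E *m y) 0 0 =
    frobenius_norm x * frobenius_norm y * (u^T *m E *m v) 0 0.
  rewrite [in LHS]Ex [in LHS]Ey.
  rewrite -scalemxAr [(_ *: u)^T]linearZ /= -!scalemxAl scalerA [LHS]mxE.
  by rewrite [frobenius_norm y * _]mulrC.
have := bilin 1%:M; rewrite !mulmx1 bilin => ->; rewrite -mulrBr.
rewrite mulmxA -mulmxA -trmx_mul normrM.
rewrite ger0_norm ?mulr_ge0 ?frobenius_ge0// [leRHS]mulrC ler_pM2l ?mulr_gt0//.
move: Fu Fv; rewrite -/u -/v => Fu Fv.
have := polarization (P *m u) (P *m v); rewrite -mulmxDr -mulmxBr.
have := polarization u v.
have : sqfrob (u + v) + sqfrob (u - v) = 4.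
  have Ndot : (u^T *m - v) 0 0 = - (u^T *m v) 0 0 by rewrite mulmxN !mxE.
  by rewrite !sqfrobD_col Nv Fu Fv Ndot; ring.
move: hp hm; rewrite !ler_distl => /andP[a1 a2] /andP[b1 b2] E1 E2 E3.
have := mulrDr delta (sqfrob (u + v)) (sqfrob (u - v)); rewrite E1 => E4.
by apply/andP; split; lra.
Qed.

Lemma random_embedding (R : realType) (I : finType) (k r : nat) (p q : I -> nat)
    (x y : I -> 'cV[R]_k) (A : forall i, 'M[R]_(k, p i))
    (B : forall i, 'M[R]_(k, q i)) (delta : R) :
  (0 < r)%N -> 0 < delta <= 1 / 2 ->
  8 * #|I|%:R * expR (- (r%:R * delta ^+ 2 / 32)) < 1 ->
  exists P : 'M[R]_(r, k), forall i,
    [/\ `|((x i)^T *m (P^T *m P) *m y i) 0 0 - ((x i)^T *m y i) 0 0| <=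
          delta * (frobenius_norm (x i) * frobenius_norm (y i)),
        sqfrob (P *m A i) <= (1 + delta) * sqfrob (A i) &
        sqfrob (P *m B i) <= (1 + delta) * sqfrob (B i)].
Proof.
move=> r0 hd small.
(* Four matrices per index, namely the normalised sum and difference, A and B, and two tails for
   each: this is the 8 of the hypothesis. *)
pose nrm (z : 'cV[R]_k) := (frobenius_norm z)^-1 *: z.
pose Q (j : bool * bool * I) :=
  if j.1.1 then 1%N else if j.1.2 then p j.2 else q j.2.
pose M (j : bool * bool * I) : 'M[R]_(k, Q j) :=
  match j return 'M[R]_(k, Q j) with
  | (true, true, i) => nrm (x i) + nrm (y i)
  | (true, false, i) => nrm (x i) - nrm (y i)
  | (false, true, i) => A i
  | (false, false, i) => B i
  end.
have [|P hP] := johnson_lindenstrauss M r0 hd.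
  rewrite !card_prod card_bool; apply: le_lt_trans small.
  by rewrite ler_wpM2r ?expR_ge0// !natrM !mulrA; lra.
exists P => i; split.
- exact: dot_distortion (hP (true, true, i)) (hP (true, false, i)).
- by have := hP (false, true, i); rewrite ler_distl => /andP[_];
  rewrite mulrDl mul1r.
- by have := hP (false, false, i); rewrite ler_distl => /andP[_];
  rewrite mulrDl mul1r.
Qed.

(** * Gluing tensor trains *)

Lemma conform_mulmx (R : realType) (p p' q q' s s' : nat) (A : 'M[R]_(p, q))
    (B : 'M[R]_(q, s)) : p = p' -> q = q' -> s = s' ->
  conform_mx (0 : 'M[R]_(p', q')) A *m conform_mx (0 : 'M[R]_(q', s')) B =
  conform_mx 0 (A *m B).
Proof. by move=> <- <- <-; rewrite !conform_mx_id. Qed.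

Lemma frobenius_conform (R : realType) (p p' q q' : nat) (A : 'M[R]_(p, q)) :
  p = p' -> q = q' ->
  frobenius_norm (conform_mx (0 : 'M[R]_(p', q')) A) = frobenius_norm A.
Proof. by move=> <- <-; rewrite conform_mx_id. Qed.

Lemma conform_const_mx (R : realType) (p p' q q' : nat) (a : R) :
  p = p' -> q = q' ->
  conform_mx (0 : 'M[R]_(p', q')) (const_mx a : 'M_(p, q)) = const_mx a.
Proof. by move=> <- <-; rewrite conform_mx_id. Qed.

(** Trades the cast in [TT] for all-ones vectors, which make sense for any dimensions and so need no
    rewriting of types. *)
Lemma castmx_11 (R : realType) (p q : nat) (ep : p = 1%N) (eq : q = 1%N)
    (M : 'M[R]_(p, q)) :
  castmx (ep, eq) M 0 0 =
  ((const_mx 1 : 'rV_p) *m M *m (const_mx 1 : 'cV_q)) 0 0.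
Proof.
subst p q; rewrite castmx_id.
by rewrite mxE big_ord1 mxE big_ord1 !mxE mulr1 mul1r.
Qed.

Lemma frobenius_const1 (R : realType) (p q : nat) : p = 1%N -> q = 1%N ->
  frobenius_norm (const_mx 1 : 'M[R]_(p, q)) = 1.
Proof.
by move=> -> ->; rewrite /frobenius_norm !big_ord1 mxE expr1n sqrtr1.
Qed.

(** * Partial products and their splitting at a bond *)

(** Indexed by all naturals, with the default 0 past the last mode, so that recursions and products
    over s carry no bound proofs. *)
Definition slice (R : realType) (d : nat) (n : 'I_d -> nat) (U : tt_fact R n)
    (i : multi_index n) (s : nat) : 'M[R]_(rk U s, rk U s.+1) :=
  match @idP (s < d)%N with
  | ReflectT lt_sd => core U (Ordinal lt_sd) (i (Ordinal lt_sd))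
  | ReflectF _ => 0
  end.

(* const_mx 1 stands for the 1 x 1 identity: the boundary ranks are only
   provably equal to 1. *)
Fixpoint tt_head (R : realType) (d : nat) (n : 'I_d -> nat) (U : tt_fact R n)
    (i : multi_index n) (m : nat) : 'rV[R]_(rk U m) :=
  if m is m'.+1 then tt_head U i m' *m slice U i m' else const_mx 1.

(** The recursion goes upwards in [s], so it runs on the number [f] of modes still to be multiplied,
    which [tt_tail] sets to d - s. *)
Fixpoint tt_tail_rec (R : realType) (d : nat) (n : 'I_d -> nat)
    (U : tt_fact R n) (i : multi_index n) (f s : nat) : 'cV[R]_(rk U s) :=
  if f is f'.+1 then slice U i s *m tt_tail_rec U i f' s.+1 else const_mx 1.

Definition tt_tail (R : realType) (d : nat) (n : 'I_d -> nat)
    (U : tt_fact R n) (i : multi_index n) (s : nat) : 'cV[R]_(rk U s) :=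
  tt_tail_rec U i (d - s) s.

Lemma slice_ord (R : realType) (d : nat) (n : 'I_d -> nat) (U : tt_fact R n)
    (i : multi_index n) (s : 'I_d) : slice U i s = core U s (i s).
Proof.
case: s => s hs; rewrite /slice /=; case: {-}_ / idP => [h|]; last by rewrite hs.
by rewrite (bool_irrelevance h hs).
Qed.

Lemma tt_tail_last (R : realType) (d : nat) (n : 'I_d -> nat)
    (U : tt_fact R n) (i : multi_index n) : tt_tail U i d = const_mx 1.
Proof. by rewrite /tt_tail subnn. Qed.

Lemma tt_tail_recl (R : realType) (d : nat) (n : 'I_d -> nat)
    (U : tt_fact R n) (i : multi_index n) (s : nat) : (s < d)%N ->
  tt_tail U i s = slice U i s *m tt_tail U i s.+1.
Proof. by move=> sd; rewrite /tt_tail -subnSK. Qed.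

Lemma tt_head_prod (R : realType) (d : nat) (n : 'I_d -> nat)
    (U : tt_fact R n) (i : multi_index n) (m : nat) (md : (m <= d)%N) :
  const_mx 1 *m tt_prod U i md = tt_head U i m.
Proof.
elim: m md => [|m IH] md /=; first by rewrite mulmx1.
by rewrite mulmxA IH -(slice_ord U i (Ordinal md)).
Qed.

(** Every entry is an inner product of two vectors at any chosen bond, the form in which the random
    embedding applies. *)
Lemma TT_head_tail (R : realType) (d : nat) (n : 'I_d -> nat)
    (U : tt_fact R n) (i : multi_index n) (m : nat) : (m <= d)%N ->
  TT U i = (tt_head U i m *m tt_tail U i m) 0 0.
Proof.
move=> md; rewrite ffunE castmx_11 tt_head_prod -(tt_tail_last U i).
suff E m' : (m' <= d)%N -> tt_head U i (d - m') *m tt_tail U i (d - m') =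
    tt_head U i d *m tt_tail U i d.
  by rewrite -(subKn md) E// leq_subr.
elim: m' => [|m' IH] hm; first by rewrite subn0.
rewrite -(IH (ltnW hm)) -(subnSK hm) tt_tail_recl ?mulmxA//.
by rewrite ltn_subrL //; case: (d) hm.
Qed.

Lemma tt_head_le (R : realType) (d : nat) (n : 'I_d -> nat)
    (U : tt_fact R n) (i : multi_index n) (m : nat) :
  frobenius_norm (tt_head U i m) <=
  \prod_(0 <= s < m) frobenius_norm (slice U i s).
Proof.
elim: m => [|m IH]; first by rewrite big_geq// frobenius_const1 ?rk_first.
rewrite big_nat_recr //=; apply: le_trans (frobenius_mul_le _ _) _.
by rewrite ler_wpM2r ?frobenius_ge0.
Qed.

Lemma tt_tail_le (R : realType) (d : nat) (n : 'I_d -> nat)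
    (U : tt_fact R n) (i : multi_index n) (m : nat) : (m <= d)%N ->
  frobenius_norm (tt_tail U i m) <=
  \prod_(m <= s < d) frobenius_norm (slice U i s).
Proof.
move=> md; rewrite -(subKn md); elim: (d - m)%N (leq_subr m d) => [|k IH] hk.
  by rewrite subn0 big_geq// tt_tail_last frobenius_const1 ?rk_last.
have lt : (d - k.+1 < d)%N by rewrite ltn_subrL //; case: (d) hk.
rewrite tt_tail_recl// big_ltn//; apply: le_trans (frobenius_mul_le _ _) _.
by rewrite ler_wpM2l ?frobenius_ge0// subnSK// IH// ltnW.
Qed.

Definition glue_rk (R : realType) (d : nat) (n : 'I_d -> nat)
    (U V : tt_fact R n) (o : 'I_d) (q m : nat) : nat :=
  if (m <= o)%N then rk U m else if m == o.+1 then q else rk V m.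

Definition glue_core (R : realType) (d : nat) (n : 'I_d -> nat)
    (U V : tt_fact R n) (o : 'I_d) (q : nat) (L : 'M[R]_(rk U o.+1, q))
    (M : 'M[R]_(q, rk V o.+1)) (s : 'I_d) :
    core3 R (glue_rk U V o q s) (n s) (glue_rk U V o q s.+1) := fun i =>
  if (s < o)%N then conform_mx 0 (core U s i)
  else if s == o :> nat then
    conform_mx 0 (core U s i *m conform_mx (0 : 'M_(rk U s.+1, q)) L)
  else if s == o.+1 :> nat then
    conform_mx 0 (conform_mx (0 : 'M_(q, rk V s)) M *m core V s i)
  else conform_mx 0 (core V s i).

Lemma glue_rk_first (R : realType) (d : nat) (n : 'I_d -> nat)
    (U V : tt_fact R n) (o : 'I_d) (q : nat) : glue_rk U V o q 0 = 1%N.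
Proof. exact: rk_first. Qed.

Lemma glue_rk_last (R : realType) (d : nat) (n : 'I_d -> nat)
    (U V : tt_fact R n) (o : 'I_d) (q : nat) :
  (o.+1 < d)%N -> glue_rk U V o q d = 1%N.
Proof.
by move=> od; rewrite /glue_rk leqNgt ltn_ord /= gtn_eqF// rk_last.
Qed.

Lemma glue_rk_gt0 (R : realType) (d : nat) (n : 'I_d -> nat)
    (U V : tt_fact R n) (o : 'I_d) (q : nat) (s : nat) :
  (0 < q)%N -> (s <= d)%N -> (0 < glue_rk U V o q s)%N.
Proof.
by move=> q0 sd; rewrite /glue_rk; do 2?case: ifP => // _; exact: rk_gt0.
Qed.

(* The cores of U before the bond o + 1 and those of V after it, with L and M
   multiplied into the two cores adjacent to the bond; conform_mx only adjusts
   the types of matrices whose dimensions are provably equal. *)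
Definition tt_glue (R : realType) (d : nat) (n : 'I_d -> nat)
    (U V : tt_fact R n) (o : 'I_d) (od : (o.+1 < d)%N) (q : nat)
    (q0 : (0 < q)%N) (L : 'M[R]_(rk U o.+1, q)) (M : 'M[R]_(q, rk V o.+1)) :
    tt_fact R n :=
  TTFact (glue_core L M) (glue_rk_first U V o q) (glue_rk_last U V q od)
    (fun s => glue_rk_gt0 U V o q0).

Lemma glue_rk_le (R : realType) (d : nat) (n : 'I_d -> nat)
    (U V : tt_fact R n) (o : 'I_d) (q m : nat) :
  (m <= o)%N -> glue_rk U V o q m = rk U m.
Proof. by rewrite /glue_rk => ->. Qed.

Lemma glue_rk_eq (R : realType) (d : nat) (n : 'I_d -> nat)
    (U V : tt_fact R n) (o : 'I_d) (q : nat) : glue_rk U V o q o.+1 = q.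
Proof. by rewrite /glue_rk ltnn eqxx. Qed.

Lemma glue_rk_gt (R : realType) (d : nat) (n : 'I_d -> nat)
    (U V : tt_fact R n) (o : 'I_d) (q m : nat) :
  (o.+1 < m)%N -> glue_rk U V o q m = rk V m.
Proof.
by move=> om; rewrite /glue_rk leqNgt (ltn_trans _ om)//= gtn_eqF.
Qed.

Lemma glue_core_lt (R : realType) (d : nat) (n : 'I_d -> nat)
    (U V : tt_fact R n) (o : 'I_d) (q : nat) (L : 'M[R]_(rk U o.+1, q))
    (M : 'M[R]_(q, rk V o.+1)) (s : 'I_d) i : (s < o)%N ->
  glue_core L M i = conform_mx 0 (core U s i).
Proof. by move=> so; rewrite /glue_core so. Qed.

Lemma glue_core_left (R : realType) (d : nat) (n : 'I_d -> nat)
    (U V : tt_fact R n) (o : 'I_d) (q : nat) (L : 'M[R]_(rk U o.+1, q))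
    (M : 'M[R]_(q, rk V o.+1)) (i : 'I_(n o)) :
  glue_core L M i = conform_mx 0 (core U o i *m L).
Proof. by rewrite /glue_core ltnn eqxx conform_mx_id. Qed.

Lemma glue_core_right (R : realType) (d : nat) (n : 'I_d -> nat)
    (U V : tt_fact R n) (o : 'I_d) (od : (o.+1 < d)%N) (q : nat)
    (L : 'M[R]_(rk U o.+1, q)) (M : 'M[R]_(q, rk V o.+1))
    (i : 'I_(n (Ordinal od))) :
  glue_core L M i = conform_mx 0 (M *m core V (Ordinal od) i).
Proof.
rewrite /glue_core /= ltnNge leqnSn /= gtn_eqF//= eqxx.
by rewrite [X in X *m _]conform_mx_id.
Qed.

Lemma glue_core_gt (R : realType) (d : nat) (n : 'I_d -> nat)
    (U V : tt_fact R n) (o : 'I_d) (q : nat) (L : 'M[R]_(rk U o.+1, q))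
    (M : 'M[R]_(q, rk V o.+1)) (s : 'I_d) i : (o.+1 < s)%N ->
  glue_core L M i = conform_mx 0 (core V s i).
Proof.
move=> os; rewrite /glue_core ltnNge (ltnW (ltnW os)) /=.
by rewrite !gtn_eqF// ltnW.
Qed.

Lemma slice_glue_lt (R : realType) (d : nat) (n : 'I_d -> nat)
    (U V : tt_fact R n) (o : 'I_d) (od : (o.+1 < d)%N) (q : nat)
    (q0 : (0 < q)%N) (L : 'M[R]_(rk U o.+1, q)) (M : 'M[R]_(q, rk V o.+1))
    (i : multi_index n) (s : nat) : (s < o)%N ->
  slice (tt_glue od q0 L M) i s = conform_mx 0 (slice U i s).
Proof.
move=> so; have sd : (s < d)%N := ltn_trans so (ltn_ord o).
rewrite -[s]/(nat_of_ord (Ordinal sd)) !slice_ord.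
exact: glue_core_lt.
Qed.

Lemma slice_glue_gt (R : realType) (d : nat) (n : 'I_d -> nat)
    (U V : tt_fact R n) (o : 'I_d) (od : (o.+1 < d)%N) (q : nat)
    (q0 : (0 < q)%N) (L : 'M[R]_(rk U o.+1, q)) (M : 'M[R]_(q, rk V o.+1))
    (i : multi_index n) (s : nat) : (o.+1 < s < d)%N ->
  slice (tt_glue od q0 L M) i s = conform_mx 0 (slice V i s).
Proof.
move=> /andP[os sd]; rewrite -[s]/(nat_of_ord (Ordinal sd)) !slice_ord.
exact: glue_core_gt.
Qed.

Lemma slice_glue_left (R : realType) (d : nat) (n : 'I_d -> nat)
    (U V : tt_fact R n) (o : 'I_d) (od : (o.+1 < d)%N) (q : nat)
    (q0 : (0 < q)%N) (L : 'M[R]_(rk U o.+1, q)) (M : 'M[R]_(q, rk V o.+1))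
    (i : multi_index n) :
  slice (tt_glue od q0 L M) i o = conform_mx 0 (slice U i o *m L).
Proof. by rewrite !slice_ord /= glue_core_left. Qed.

Lemma slice_glue_right (R : realType) (d : nat) (n : 'I_d -> nat)
    (U V : tt_fact R n) (o : 'I_d) (od : (o.+1 < d)%N) (q : nat)
    (q0 : (0 < q)%N) (L : 'M[R]_(rk U o.+1, q)) (M : 'M[R]_(q, rk V o.+1))
    (i : multi_index n) :
  slice (tt_glue od q0 L M) i o.+1 = conform_mx 0 (M *m slice V i o.+1).
Proof.
rewrite -[o.+1]/(nat_of_ord (Ordinal od)) !slice_ord /=.
exact: glue_core_right.
Qed.

(** U and V may differ. Taking U = V gives gauge changes, rank truncations and the insertion of P^T
    P; distinct U and V give the mixed factorization. *)
Lemma TT_glue (R : realType) (d : nat) (n : 'I_d -> nat)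
    (U V : tt_fact R n) (o : 'I_d) (od : (o.+1 < d)%N) (q : nat)
    (q0 : (0 < q)%N) (L : 'M[R]_(rk U o.+1, q)) (M : 'M[R]_(q, rk V o.+1))
    (i : multi_index n) :
  TT (tt_glue od q0 L M) i =
  (tt_head U i o.+1 *m (L *m M) *m tt_tail V i o.+1) 0 0.
Proof.
set H := tt_glue od q0 L M.
have hd m : (m <= o)%N -> tt_head H i m = conform_mx 0 (tt_head U i m).
  elim: m => [|m IH] mo /=.
    by rewrite conform_const_mx// !rk_first.
  rewrite IH 1?ltnW// slice_glue_lt// conform_mulmx//.
    by rewrite /= glue_rk_le// ltnW.
  by rewrite /= glue_rk_le.
have tl k m : (k + m = d)%N -> (o.+1 < m)%N ->
    tt_tail H i m = conform_mx 0 (tt_tail V i m).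
  elim: k m => [|k IH] m; first by rewrite add0n => -> _;
    rewrite !tt_tail_last conform_const_mx// !rk_last.
  move=> km om; have md : (m < d)%N by lia.
  rewrite tt_tail_recl// [tt_tail V i m]tt_tail_recl// slice_glue_gt ?om ?md//
    IH; [|lia|lia].
  by rewrite conform_mulmx//= glue_rk_gt// ltnW.
have e1 : rk U o = rk H o by rewrite /= glue_rk_le.
have e2 : q = rk H o.+1 by rewrite /= glue_rk_eq.
have e3 : rk V o.+2 = rk H o.+2 by rewrite /= glue_rk_gt.
rewrite (TT_head_tail _ _ (ltnW od)) tt_tail_recl// [tt_head _ _ _]/= hd//.
rewrite slice_glue_left slice_glue_right (tl _ _ (subnK od))//.
rewrite (conform_mulmx _ _ (erefl 1%N) e1 e2).
rewrite (conform_mulmx _ _ e2 e3 (erefl 1%N)).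
rewrite (conform_mulmx _ _ (erefl 1%N) e2 (erefl 1%N)) conform_mx_id.
by rewrite [in RHS]tt_tail_recl// !mulmxA.
Qed.

(** * Rank reduction bond by bond *)

Definition core_norms (R : realType) (d : nat) (n : 'I_d -> nat)
    (U : tt_fact R n) (i : multi_index n) : R :=
  \prod_(0 <= s < d) frobenius_norm (slice U i s).

Lemma core_norms_glue (R : realType) (d : nat) (n : 'I_d -> nat)
    (U V : tt_fact R n) (o : 'I_d) (od : (o.+1 < d)%N) (q : nat)
    (q0 : (0 < q)%N) (L : 'M[R]_(rk U o.+1, q)) (M : 'M[R]_(q, rk V o.+1))
    (i : multi_index n) :
  core_norms (tt_glue od q0 L M) i =
  (\prod_(0 <= s < o) frobenius_norm (slice U i s)) *
  frobenius_norm (slice U i o *m L) * frobenius_norm (M *m slice V i o.+1) *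
  \prod_(o.+2 <= s < d) frobenius_norm (slice V i s).
Proof.
rewrite /core_norms (big_cat_nat _ (n := o)) //=; last by rewrite ltnW.
rewrite [\prod_(nat_of_ord o <= _ < d) _]big_ltn//.
rewrite [\prod_(o.+1 <= _ < d) _]big_ltn// !mulrA; congr (_ * _ * _ * _).
- rewrite !big_mkord; apply: eq_bigr => s _; rewrite slice_glue_lt//.
  by rewrite frobenius_conform//= glue_rk_le// ltnW.
- rewrite slice_glue_left frobenius_conform//=; first by rewrite glue_rk_le.
  by rewrite glue_rk_eq.
- rewrite slice_glue_right frobenius_conform//=; first by rewrite glue_rk_eq.
  by rewrite glue_rk_gt.
- rewrite !big_nat; apply: eq_bigr => s /andP[os sd].
  rewrite slice_glue_gt ?os ?sd//.
  by rewrite frobenius_conform//= glue_rk_gt// ltnW.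
Qed.

Lemma core_norms_ge0 (R : realType) (d : nat) (n : 'I_d -> nat)
    (U : tt_fact R n) (i : multi_index n) : 0 <= core_norms U i.
Proof. by apply: prodr_ge0 => s _; exact: frobenius_ge0. Qed.

Lemma core_norms_split (R : realType) (d : nat) (n : 'I_d -> nat)
    (U : tt_fact R n) (i : multi_index n) (o : nat) : (o.+1 < d)%N ->
  core_norms U i =
  (\prod_(0 <= s < o) frobenius_norm (slice U i s)) *
  frobenius_norm (slice U i o) * frobenius_norm (slice U i o.+1) *
  \prod_(o.+2 <= s < d) frobenius_norm (slice U i s).
Proof.
move=> od; rewrite /core_norms (big_cat_nat _ (n := o)) //=; last by lia.
rewrite [\prod_(o <= _ < d) _]big_ltn; last by lia.
by rewrite [\prod_(o.+1 <= _ < d) _]big_ltn// !mulrA.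
Qed.

(** The norms of head and tail are at most the products of slice norms on either side, whose product
    is [core_norms]. Each of the two slices next to the bond grows by at most sqrt (1 + delta), so
    [core_norms] grows by at most 1 + delta <= 2. *)
Lemma tt_bond_reduction (R : realType) (d : nat) (n : 'I_d -> nat)
    (U : tt_fact R n) (o r : nat) (delta : R) :
  (o.+1 < d)%N -> (0 < r)%N -> 0 < delta <= 1 / 2 ->
  8 * #|multi_index n|%:R * expR (- (r%:R * delta ^+ 2 / 32)) < 1 ->
  exists U' : tt_fact R n,
    [/\ rk U' o.+1 = r, forall s, s != o.+1 -> rk U' s = rk U s &
      forall i, `|TT U i - TT U' i| <= delta * core_norms U i /\
                core_norms U' i <= 2 * core_norms U i].
Proof.
move=> od r0 hd small; have od' : (o < d)%N := ltnW od.
(* The core before the bond is multiplied by P^T from the right, hence the transposed slices. *)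
have [P hP] := random_embedding (fun i => (tt_head U i o.+1)^T)
  (fun i => tt_tail U i o.+1) (fun i => (slice U i o)^T)
  (fun i => slice U i o.+1) r0 hd small.
have odo : ((Ordinal od').+1 < d)%N by [].
exists (@tt_glue _ _ _ U U (Ordinal od') odo r r0 P^T P).
split=> [|s so|i]; first exact: glue_rk_eq.
  by rewrite /= /glue_rk (negPf so); case: ifP.
have [h1 h2 h3] := hP i; split.
  rewrite TT_glue (TT_head_tail U i (ltnW od)) distrC.
  move: h1; rewrite trmxK => /le_trans; apply.
  case/andP: hd => d0 _; rewrite ler_pM2l// frobenius_tr.
  rewrite /core_norms (big_cat_nat _ (n := o.+1)) //=.
  by apply: ler_pM; rewrite ?frobenius_ge0 ?tt_head_le // tt_tail_le.
have d1 : 0 <= 1 + delta by case/andP: hd; lra.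
have fro_le p q p' q' (M : 'M[R]_(p, q)) (N : 'M[R]_(p', q')) :
    sqfrob M <= (1 + delta) * sqfrob N ->
    frobenius_norm M <= Num.sqrt (1 + delta) * frobenius_norm N.
  by move=> h; rewrite /frobenius_norm -sqrtrM// ler_sqrt// mulr_ge0// sqfrob_ge0.
move/fro_le in h2; move/fro_le in h3.
rewrite core_norms_glue (core_norms_split _ _ od).
rewrite -[slice U i _ *m P^T]trmxK trmx_mul trmxK frobenius_tr.
rewrite frobenius_tr in h2.
rewrite mulrA ler_wpM2r ?prodr_ge0// => [s _|]; first exact: frobenius_ge0.
rewrite -!mulrA [leRHS]mulrCA ler_wpM2l ?prodr_ge0// => [s _|].
  exact: frobenius_ge0.
apply: le_trans (ler_pM _ _ h2 h3) _; rewrite ?frobenius_ge0//.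
rewrite mulrACA -expr2 sqr_sqrtr// ler_wpM2r ?mulr_ge0 ?frobenius_ge0//.
by case/andP: hd; lra.
Qed.

(** After m bonds [core_norms] has grown by at most 2^m, so the next error is at most 2^m delta
    [core_norms U i], and the errors sum geometrically to (2^m - 1) delta. The size condition on r
    involves no rank and is the same at every bond. *)
Lemma tt_rank_reduction (R : realType) (d : nat) (n : 'I_d -> nat)
    (U : tt_fact R n) (r : nat) (delta : R) :
  (0 < r)%N -> 0 < delta <= 1 / 2 ->
  8 * #|multi_index n|%:R * expR (- (r%:R * delta ^+ 2 / 32)) < 1 ->
  exists U' : tt_fact R n, (forall s, (0 < s < d)%N -> rk U' s = r) /\
    forall i, `|TT U i - TT U' i| <= 2 ^+ d * delta * core_norms U i.
Proof.
move=> r0 hd small; have d0 : 0 < delta by case/andP: hd.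
suff : forall m, (m <= d)%N -> exists U' : tt_fact R n,
    (forall s, (0 < s < d)%N -> (s < m.+1)%N -> rk U' s = r) /\
    forall i, `|TT U i - TT U' i| <= (2 ^+ m - 1) * delta * core_norms U i /\
              core_norms U' i <= 2 ^+ m * core_norms U i.
  move=> /(_ d (leqnn d)) [U' [rkU' hU']]; exists U'; split=> [s sd|i].
    by apply: rkU' => //; case/andP: sd => _ /ltnW.
  apply: le_trans (proj1 (hU' i)) _.
  rewrite ler_wpM2r ?core_norms_ge0// ler_wpM2r ?ltW//; lra.
elim=> [|m IH] md.
  exists U; split=> [[|s]//|i].
  by rewrite !expr0 !subrr !mul0r normr0 mul1r.
have [U' [rkU' hU']] := IH (ltnW md).
have [lt|ge] := ltnP m.+1 d; last first.
  exists U'; split=> [s /andP[s0 sd] _|i].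
    by apply: rkU'; rewrite ?s0//; lia.
  have [h1 h2] := hU' i; have c0 := core_norms_ge0 U i.
  have : 0 <= 2 ^+ m * core_norms U i by rewrite mulr_ge0// exprn_ge0.
  have : 0 <= 2 ^+ m * (delta * core_norms U i).
    by rewrite !mulr_ge0// ?exprn_ge0// ltW.
  by rewrite exprS; split; nra.
have [U'' [rk1 rk2 hU'']] := tt_bond_reduction U' lt r0 hd small.
exists U''; split=> [s sd sm|i].
  have [->|ne] := eqVneq s m.+1; first exact: rk1.
  by rewrite rk2// rkU'//; lia.
have [h1 h2] := hU' i; have [h3 h4] := hU'' i.
rewrite exprS; split; last by lra.
have -> : TT U i - TT U'' i = (TT U i - TT U' i) + (TT U' i - TT U'' i) by ring.
apply: le_trans (ler_normD _ _) _.
have : delta * core_norms U' i <= delta * (2 ^+ m * core_norms U i).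
  by rewrite ler_pM2l.
by move=> h5; lra.
Qed.

(** * Minimal and orthogonal factorizations *)

(** Induction on the rows: the first row is replaced by its normalised component orthogonal to the
    others, nonzero because the rows are independent. Equality of the row spaces follows from one
    inclusion and equal ranks. *)
Lemma gram_schmidt (R : realType) (k m : nat) (M : 'M[R]_(k, m)) :
  row_free M ->
  exists Q : 'M[R]_(k, m), Q *m Q^T = 1%:M /\ (Q :=: M)%MS.
Proof.
elim: k M => [|k IH].
  move=> M _; exists M; split=> //.
  by rewrite [LHS]flatmx0 [RHS]flatmx0.
change k.+1 with (1 + k)%N => M; rewrite -[M]vsubmxK.
set v := usubmx M; set M' := dsubmx M => free.
have rk_vM : \rank (v + M')%MS = (1 + k)%N by rewrite addsmxE; exact/eqP.
have free' : row_free M'.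
  rewrite /row_free eqn_leq rank_leq_row /=.
  by have := mxrank_adds_leqif v M'; rewrite rk_vM => -[+ _];
    have := rank_leq_row v; lia.
have [Q' [QQ' eqQ']] := IH _ free'.
pose w := v - v *m Q'^T *m Q'.
have wQ' : w *m Q'^T = 0 by rewrite mulmxBl -!mulmxA QQ' mulmx1 subrr.
have w0 : w != 0.
  apply/eqP => w0; have vM' : (v <= M')%MS.
    by rewrite -eqQ' -[v](subrK (v *m Q'^T *m Q')) -/w w0 add0r submxMl.
  have := rank_leq_row M'; rewrite -(addsmx_idPr vM') rk_vM; lia.
have fw : frobenius_norm w != 0.
  by rewrite -sqrf_eq0 sqr_frobenius sqfrob_eq0.
pose Q := col_mx ((frobenius_norm w)^-1 *: w) Q'.
have QQ : Q *m Q^T = 1%:M.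
  rewrite tr_col_mx mul_col_row QQ' linearZ /= -!scalemxAl -!scalemxAr wQ'.
  rewrite -[Q' *m w^T]trmxK trmx_mul trmxK wQ' trmx0 !scaler0.
  rewrite [w *m w^T]mx11_scalar -trace_mx11 -sqfrobE -sqr_frobenius.
  rewrite scalerA scale_scalar_mx -invfM -expr2 mulVf ?sqrf_eq0//.
  by rewrite -scalar_mx_block.
exists Q; split=> //; apply/eqmxP.
have QM : (Q <= col_mx v M')%MS.
  rewrite -!addsmxE addsmx_sub; apply/andP; split.
    apply/scalemx_sub/addmx_sub; first exact: addsmxSl.
    rewrite -mulNmx; apply: submx_trans (submxMl _ _) _.
    by rewrite eqQ' addsmxSr.
  by rewrite eqQ' addsmxSr.
have := mxrank_leqif_eq QM => /geq_leqif <-.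
rewrite (eqP free); apply: leq_trans (mxrankM_maxl Q Q^T).
by rewrite QQ mxrank1.
Qed.

(** Gram-Schmidt as a gauge change: S is absorbed by the core after a bond and its inverse T by the
    core before it. *)
Lemma row_free_orthonormalize (R : realType) (k m : nat) (M : 'M[R]_(k, m)) :
  row_free M -> exists T S : 'M[R]_k,
    T *m S = 1%:M /\ (S *m M) *m (S *m M)^T = 1%:M.
Proof.
move=> free; have [Q [QQ eqQ]] := gram_schmidt free.
have /submxP[S ES] : (Q <= M)%MS by rewrite eqQ.
have /submxP[T ET] : (M <= Q)%MS by rewrite -eqQ.
exists T, S; split; last by rewrite -ES.
by apply: (row_free_inj free); rewrite -mulmxA -ES -ET mul1mx.
Qed.

Lemma row_full_orthonormalize (R : realType) (k m : nat) (M : 'M[R]_(m, k)) :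
  row_full M -> exists T S : 'M[R]_k,
    T *m S = 1%:M /\ (M *m T)^T *m (M *m T) = 1%:M.
Proof.
move=> full; have /row_free_orthonormalize[T [S [TS o]]] : row_free M^T.
  by rewrite /row_free mxrank_tr.
exists S^T, T^T; rewrite -trmx_mul TS trmx1; split=> //.
by move: o; rewrite !trmx_mul !trmxK.
Qed.

Lemma left_unfoldingE (R : realType) (p n q : nat) (G : core3 R p n q) i a b :
  left_unfolding G (mxvec_index i a) b = G i a b.
Proof. by rewrite mxE mxvecE mxE. Qed.

Lemma right_unfoldingE (R : realType) (p n q : nat) (G : core3 R p n q) i a b :
  right_unfolding G a (mxvec_index i b) = G i a b.
Proof. by rewrite mxE mxvecE mxE. Qed.

Lemma left_unfoldingM (R : realType) (p n q s : nat) (G : core3 R p n q)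
    (T : 'M[R]_(q, s)) :
  left_unfolding (fun i => G i *m T) = left_unfolding G *m T.
Proof.
apply/matrixP => k b; case/mxvec_indexP: k => i a.
rewrite left_unfoldingE !mxE; apply: eq_bigr => c _.
by rewrite left_unfoldingE.
Qed.

Lemma right_unfoldingM (R : realType) (p n q s : nat) (G : core3 R p n q)
    (T : 'M[R]_(s, p)) :
  right_unfolding (fun i => T *m G i) = T *m right_unfolding G.
Proof.
apply/matrixP => a k; case/mxvec_indexP: k => i b.
rewrite right_unfoldingE !mxE; apply: eq_bigr => c _.
by rewrite right_unfoldingE.
Qed.

Lemma left_unfolding_inj (R : realType) (p n q : nat) (G H : core3 R p n q) :
  left_unfolding G = left_unfolding H -> forall i, G i = H i.
Proof.
by move=> /matrixP e i; apply/matrixP => a b; rewrite -!left_unfoldingE e.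
Qed.

Lemma right_unfolding_inj (R : realType) (p n q : nat) (G H : core3 R p n q) :
  right_unfolding G = right_unfolding H -> forall i, G i = H i.
Proof.
by move=> /matrixP e i; apply/matrixP => a b; rewrite -!right_unfoldingE e.
Qed.

Lemma left_orthogonal_conform (R : realType) (p q p' q' n : nat)
    (G : core3 R p n q) (H : core3 R p' n q') :
  p = p' -> q = q' -> (forall i, H i = conform_mx 0 (G i)) ->
  left_orthogonal G -> left_orthogonal H.
Proof.
move=> ep eq; subst p' q' => e; suff -> : H = G by [].
by apply/funext => i; rewrite e conform_mx_id.
Qed.

Lemma right_orthogonal_conform (R : realType) (p q p' q' n : nat)
    (G : core3 R p n q) (H : core3 R p' n q') :
  p = p' -> q = q' -> (forall i, H i = conform_mx 0 (G i)) ->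
  right_orthogonal G -> right_orthogonal H.
Proof.
move=> ep eq; subst p' q' => e; suff -> : H = G by [].
by apply/funext => i; rewrite e conform_mx_id.
Qed.

(** * Gauge changes and rank-minimal factorizations *)

Lemma TT_core0 (R : realType) (d : nat) (n : 'I_d -> nat) (U : tt_fact R n)
    (s : 'I_d) : (forall i, core U s i = 0) -> TT U = 0.
Proof.
move=> c0; apply/ffunP => i; rewrite (TT_head_tail U i (ltn_ord s)) /=.
by rewrite slice_ord c0 mulmx0 mul0mx mxE ffunE.
Qed.

(** T S has to fix the left unfolding only and need not be the identity, so [q] may be smaller than
    the old rank. This covers rank truncation as well as invertible gauge changes. *)
Lemma TT_gauge_left (R : realType) (d : nat) (n : 'I_d -> nat)
    (U : tt_fact R n) (o : 'I_d) (od : (o.+1 < d)%N) (q : nat) (q0 : (0 < q)%N)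
    (T : 'M[R]_(rk U o.+1, q)) (S : 'M[R]_(q, rk U o.+1)) :
  left_unfolding (core U o) *m (T *m S) = left_unfolding (core U o) ->
  TT (tt_glue od q0 T S) = TT U.
Proof.
rewrite -left_unfoldingM => /left_unfolding_inj e; apply/ffunP => i.
rewrite TT_glue (TT_head_tail U i (ltnW od)) /= slice_ord.
by rewrite -[tt_head U i o *m _ *m _]mulmxA e.
Qed.

Lemma TT_gauge_right (R : realType) (d : nat) (n : 'I_d -> nat)
    (U : tt_fact R n) (o : 'I_d) (od : (o.+1 < d)%N) (q : nat) (q0 : (0 < q)%N)
    (T : 'M[R]_(rk U o.+1, q)) (S : 'M[R]_(q, rk U o.+1)) :
  (T *m S) *m right_unfolding (core U (Ordinal od)) =
    right_unfolding (core U (Ordinal od)) ->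
  TT (tt_glue od q0 T S) = TT U.
Proof.
rewrite -right_unfoldingM => /right_unfolding_inj e; apply/ffunP => i.
rewrite TT_glue (TT_head_tail U i (ltnW od)) tt_tail_recl//.
by rewrite (slice_ord U i (Ordinal od)) -[_ *m (T *m S) *m _]mulmxA
  [T *m S *m _]mulmxA e.
Qed.

(** The sum of all ranks is one natural number, so a minimiser exists by well-ordering; that a
    componentwise smallest rank tuple is attained is not clear beforehand. *)
Definition rank_minimal (R : realType) (d : nat) (n : 'I_d -> nat)
    (U : tt_fact R n) : Prop :=
  forall U' : tt_fact R n, TT U' = TT U ->
    (\sum_(s < d.+1) rk U s <= \sum_(s < d.+1) rk U' s)%N.

Lemma exists_rank_minimal (R : realType) (d : nat) (n : 'I_d -> nat)
    (U : tt_fact R n) : exists2 U', TT U' = TT U & rank_minimal U'.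
Proof.
pose P k := `[< exists2 U', TT U' = TT U & (\sum_(s < d.+1) rk U' s)%N = k >].
have exP : exists k, P k
  by exists (\sum_(s < d.+1) rk U s)%N; apply/asboolP; exists U.
case: (ex_minnP exP) => k /asboolP[U' eU' <-] min.
exists U' => // U'' eU''; apply: min; apply/asboolP; exists U'' => //.
by rewrite eU''.
Qed.

Lemma rank_minimal_bond (R : realType) (d : nat) (n : 'I_d -> nat)
    (U : tt_fact R n) (o : 'I_d) (od : (o.+1 < d)%N) (q : nat)
    (q0 : (0 < q)%N) (T : 'M[R]_(rk U o.+1, q)) (S : 'M[R]_(q, rk U o.+1)) :
  rank_minimal U -> TT (tt_glue od q0 T S) = TT U -> (rk U o.+1 <= q)%N.
Proof.
move=> min /min; rewrite (bigD1 (inord o.+1)) //= [leqRHS](bigD1 (inord o.+1)) //=.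
have od1 : (o.+1 < d.+1)%N by rewrite ltnS ltnW.
rewrite inordK// glue_rk_eq => h.
rewrite -(leq_add2r (\sum_(s < d.+1 | s != inord o.+1) rk U s)).
apply: leq_trans h _; rewrite leq_add2l leq_eqVlt; apply/orP; left; apply/eqP.
apply: eq_bigr => s so; rewrite /glue_rk; case: ifP => // _; case: eqP => // e.
by case/eqP: so; apply: val_inj; rewrite /= inordK.
Qed.

(* If an unfolding of a core were rank deficient, a factorization of it through
   its rank would lower the rank of U at the adjacent bond. *)
Lemma rank_minimal_tt (R : realType) (d : nat) (n : 'I_d -> nat)
    (U : tt_fact R n) : TT U != 0 -> rank_minimal U -> minimal_tt U.
Proof.
move=> U0 min s.
have core0 : ~ forall i, core U s i = 0
  by move=> h; rewrite (TT_core0 h) eqxx in U0.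
split.
  have r0 : (0 < \rank (left_unfolding (core U s)))%N.
    rewrite lt0n mxrank_eq0; apply/eqP => e; apply: core0 => i.
    by apply/matrixP => a b; rewrite -left_unfoldingE e !mxE.
  rewrite /row_full eqn_leq rank_leq_col /=.
  have [sd|ds] := ltnP s.+1 d.
    set G := left_unfolding _ in r0 *.
    apply: (@rank_minimal_bond _ _ _ U s sd _ r0 (pinvmx (row_base G))
      (row_base G) min).
    by apply: TT_gauge_left; rewrite mulmxA mulmxKpV// eq_row_base.
  (* After the last core the rank is 1, so a nonzero unfolding already has full rank. *)
  apply: leq_trans r0; have -> : s.+1 = d by apply/eqP; rewrite eqn_leq ltn_ord.
  by rewrite rk_last.
have r0 : (0 < \rank (right_unfolding (core U s)))%N.
  rewrite lt0n mxrank_eq0; apply/eqP => e; apply: core0 => i.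
  by apply/matrixP => a b; rewrite -right_unfoldingE e !mxE.
rewrite /row_free eqn_leq rank_leq_row /=.
case: s core0 r0 => -[|o] sd core0 r0.
  by apply: leq_trans r0; rewrite /= rk_first.
set G := right_unfolding _ in r0 *.
apply: (@rank_minimal_bond _ _ _ U (Ordinal (ltnW sd)) sd _ r0 (col_base G)
  (pinvmx (col_base G)) min).
apply: TT_gauge_right; rewrite -/G.
have pinvK p k m (C : 'M[R]_(p, k)) (B : 'M_(k, m)) (N : 'M_(p, m)) :
    C *m B = N -> row_full C -> C *m pinvmx C *m N = N.
  by move=> <- full; rewrite mulmxA -(mulmxA C) mulVpmx// mulmx1.
exact: pinvK (mulmx_base G) (col_base_full G).
Qed.

(** [rank_minimal] depends only on the tensor and the ranks, which an invertible gauge change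
    preserves; the orthogonalising sweeps therefore carry it and recover [minimal_tt] whenever full
    rank is required. *)
Lemma rank_minimal_gauge (R : realType) (d : nat) (n : 'I_d -> nat)
    (U : tt_fact R n) (o : 'I_d) (od : (o.+1 < d)%N) (q0 : (0 < rk U o.+1)%N)
    (T S : 'M[R]_(rk U o.+1)) : T *m S = 1%:M -> rank_minimal U ->
  TT (tt_glue od q0 T S) = TT U /\ rank_minimal (tt_glue od q0 T S).
Proof.
move=> TS min; have e : TT (tt_glue od q0 T S) = TT U.
  by apply: TT_gauge_left; rewrite TS mulmx1.
split=> // U'; rewrite e => /min; congr (_ <= _)%N.
apply: eq_bigr => s _; rewrite /= /glue_rk; case: ifP => // _.
by case: eqP => // ->.
Qed.

(** A sweep from left to right: orthogonalising core m alters only that core and the next, so the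
    cores already treated stay left-orthogonal. *)
Lemma exists_left_orthogonal (R : realType) (d : nat) (n : 'I_d -> nat)
    (U : tt_fact R n) : TT U != 0 ->
  exists U', [/\ TT U' = TT U, minimal_tt U' & left_orthogonal_tt U'].
Proof.
move=> U0.
suff : forall m, exists U' : tt_fact R n, [/\ TT U' = TT U, rank_minimal U' &
    forall s : 'I_d, (s < m)%N -> (s.+1 < d)%N -> left_orthogonal (core U' s)].
  move=> /(_ d)[U' [e min lo]]; exists U'; split=> // [|s].
    by apply: rank_minimal_tt; rewrite ?e.
  exact: lo.
elim=> [|m [U' [e min lo]]].
  by have [U' e min] := exists_rank_minimal U; exists U'.
have [md|dm] := ltnP m.+1 d; last first.
  by exists U'; split=> // s _ sd; apply: lo => //; lia.
pose o := Ordinal (ltnW md); have od : (o.+1 < d)%N by [].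
have U'0 : TT U' != 0 by rewrite e.
have [/row_full_orthonormalize[T [S [TS ort]]] _] := rank_minimal_tt U'0 min o.
have q0 : (0 < rk U' o.+1)%N by apply: rk_gt0; exact: ltnW.
have [e' min'] := rank_minimal_gauge od q0 TS min.
exists (tt_glue od q0 T S); split=> //; first by rewrite e'.
move=> s; rewrite ltnS leq_eqVlt => /orP[/eqP sm|sm] sd.
  have -> : s = o by apply: val_inj.
  apply: left_orthogonal_conform (glue_core_left T S) _.
  - by rewrite /= glue_rk_le.
  - by rewrite /= glue_rk_eq.
  - by rewrite /left_orthogonal left_unfoldingM.
apply: (left_orthogonal_conform _ _ (fun i => glue_core_lt T S i _)) (lo s sm sd) => //.
- by rewrite /= glue_rk_le// ltnW.
- by rewrite /= glue_rk_le.
Qed.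

Lemma exists_right_orthogonal (R : realType) (d : nat) (n : 'I_d -> nat)
    (U : tt_fact R n) : TT U != 0 ->
  exists U', [/\ TT U' = TT U, minimal_tt U' & right_orthogonal_tt U'].
Proof.
move=> U0.
suff : forall m, exists U' : tt_fact R n, [/\ TT U' = TT U, rank_minimal U' &
    forall s : 'I_d, (d <= m + s)%N -> (0 < s)%N -> right_orthogonal (core U' s)].
  move=> /(_ d)[U' [e min lo]]; exists U'; split=> // [|s].
    by apply: rank_minimal_tt; rewrite ?e.
  by apply: lo; rewrite leq_addr.
elim=> [|m [U' [e min lo]]].
  have [U' e min] := exists_rank_minimal U; exists U'; split=> // s.
  by rewrite add0n leqNgt ltn_ord.
have [md|dm] := ltnP m.+1 d; last first.
  by exists U'; split=> // s _ s0; apply: lo => //; lia.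
(* The sweep now runs from the right. The core to be treated is d - m.+1, just after the bond, so
   [o] is one less. *)
have o_lt : (d - m.+2 < d)%N by lia.
pose o := Ordinal o_lt; have od : (o.+1 < d)%N by rewrite /=; lia.
have U'0 : TT U' != 0 by rewrite e.
have [_ /row_free_orthonormalize[T [S [TS ort]]]] :=
  rank_minimal_tt U'0 min (Ordinal od).
have q0 : (0 < rk U' o.+1)%N by apply: rk_gt0; exact: ltnW.
have [e' min'] := rank_minimal_gauge od q0 TS min.
exists (tt_glue od q0 T S); split=> //; first by rewrite e'.
move=> s sm s0; have [so|so] := eqVneq (s : nat) o.+1.
  have -> : s = Ordinal od by apply: val_inj.
  apply: right_orthogonal_conform (glue_core_right T S) _.
  - by rewrite /= glue_rk_eq.
  - by rewrite /= glue_rk_gt.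
  - by rewrite /right_orthogonal right_unfoldingM.
have os : (o.+1 < s)%N by move: sm so; rewrite /=; lia.
apply: (right_orthogonal_conform _ _ (fun i => glue_core_gt T S i os)) (lo s _ s0).
- by rewrite /= glue_rk_gt.
- by rewrite /= glue_rk_gt// ltnW.
- by move: os; rewrite /=; lia.
Qed.

(** * Ranks of the unfoldings and the TT rank *)

Definition set_index (d : nat) (n : 'I_d -> nat) (i : multi_index n) (s : 'I_d)
    (a : 'I_(n s)) : multi_index n :=
  [ffun u => dfwith (T := fun u => 'I_(n u)) i a u].

Lemma set_index_eq (d : nat) (n : 'I_d -> nat) (i : multi_index n) (s : 'I_d)
    (a : 'I_(n s)) : set_index i a s = a.
Proof. by rewrite ffunE dfwith_in. Qed.

Lemma set_index_neq (d : nat) (n : 'I_d -> nat) (i : multi_index n)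
    (s u : 'I_d) (a : 'I_(n s)) : s != u -> set_index i a u = i u.
Proof. by move=> su; rewrite ffunE dfwith_out. Qed.

Lemma eq_slice (R : realType) (d : nat) (n : 'I_d -> nat) (U : tt_fact R n)
    (i j : multi_index n) (s : nat) :
  (forall u : 'I_d, u = s :> nat -> i u = j u) -> slice U i s = slice U j s.
Proof.
move=> e; have [sd|ds] := ltnP s d.
  by rewrite -[s]/(nat_of_ord (Ordinal sd)) !slice_ord e.
by rewrite /slice; case: {-}_ / idP => // h; exfalso; move: h;
  rewrite ltnNge ds.
Qed.

Lemma eq_tt_head (R : realType) (d : nat) (n : 'I_d -> nat) (U : tt_fact R n)
    (i j : multi_index n) (m : nat) :
  (forall u : 'I_d, (u < m)%N -> i u = j u) -> tt_head U i m = tt_head U j m.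
Proof.
elim: m => [//|m IH] e /=; rewrite IH => [|u um]; last by rewrite e// ltnW.
by rewrite (@eq_slice _ _ _ U i j m) => // u um; rewrite e// um.
Qed.

Lemma eq_tt_tail (R : realType) (d : nat) (n : 'I_d -> nat) (U : tt_fact R n)
    (i j : multi_index n) (m : nat) :
  (forall u : 'I_d, (m <= u)%N -> i u = j u) -> tt_tail U i m = tt_tail U j m.
Proof.
rewrite /tt_tail; move: (d - m)%N => f e.
elim: f m e => [//|k IH] m e /=.
rewrite (IH m.+1) => [|u um]; last by rewrite e// ltnW.
by rewrite (@eq_slice _ _ _ U i j m) => // u um; rewrite e// um.
Qed.

Lemma const1_mull_eq0 (R : realType) (p q : nat) (v : 'M[R]_(p, q)) :
  p = 1%N -> (const_mx 1 : 'rV_p) *m v = 0 -> v = 0.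
Proof.
move=> p1; subst p => h; apply/matrixP => a b; move/matrixP: h => /(_ 0 b).
by rewrite !mxE big_ord1 !mxE mul1r (ord1 a).
Qed.

Lemma const1_mulr_eq0 (R : realType) (p q : nat) (v : 'M[R]_(p, q)) :
  q = 1%N -> v *m (const_mx 1 : 'cV_q) = 0 -> v = 0.
Proof.
move=> q1; subst q => h; apply/matrixP => a b; move/matrixP: h => /(_ a 0).
by rewrite !mxE big_ord1 !mxE mulr1 (ord1 b).
Qed.

(** Cores are stripped from v one at a time: varying mode m alone shows that the left unfolding
    kills v, and full column rank gives v = 0. [z] supplies a multi-index for the base case. *)
Lemma tt_head_inj (R : realType) (d : nat) (n : 'I_d -> nat) (U : tt_fact R n)
    (z : multi_index n) (m : nat) (v : 'cV[R]_(rk U m)) :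
  minimal_tt U -> (m <= d)%N -> (forall i, tt_head U i m *m v = 0) -> v = 0.
Proof.
move=> min; elim: m v => [|m IH] v md h.
  exact: const1_mull_eq0 (rk_first U) (h z).
pose s := Ordinal md; have [/row_fullP[B LB] _] := min s.
suff L0 : left_unfolding (core U s) *m v = 0.
  by rewrite -[v]mul1mx -LB -mulmxA L0 mulmx0.
rewrite -left_unfoldingM; apply/matrixP => k b; case/mxvec_indexP: k => a c.
rewrite left_unfoldingE; move: c b; suff -> : core U s a *m v = 0.
  by move=> c b; rewrite !mxE.
apply: IH => [|i]; first exact: ltnW.
have := h (set_index i a); rewrite /= (slice_ord U _ s) set_index_eq -mulmxA => <-.
congr (_ *m _); apply: eq_tt_head => u um; rewrite set_index_neq//.
by apply: contraTneq um => <-; rewrite /= ltnn.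
Qed.

Lemma tt_tail_inj (R : realType) (d : nat) (n : 'I_d -> nat) (U : tt_fact R n)
    (z : multi_index n) (m : nat) (v : 'rV[R]_(rk U m)) :
  minimal_tt U -> (m <= d)%N -> (forall i, v *m tt_tail U i m = 0) -> v = 0.
Proof.
move=> min md; have [k km] : exists k, (k + m = d)%N.
  by exists (d - m)%N; rewrite subnK.
elim: k m v md km => [|k IH] m v md km h.
  rewrite add0n in km; apply: (@const1_mulr_eq0 _ _ _ v);
    first by rewrite km rk_last.
  by move: (h z); move: v {h}; rewrite km tt_tail_last.
have sd : (m < d)%N by lia.
pose s := Ordinal sd; have [_ /row_freeP[B LB]] := min s.
suff L0 : v *m right_unfolding (core U s) = 0.
  by rewrite -[v]mulmx1 -LB mulmxA L0 mul0mx.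
rewrite -right_unfoldingM; apply/matrixP => c k'; case/mxvec_indexP: k' => a b.
rewrite right_unfoldingE; move: c b; suff -> : v *m core U s a = 0.
  by move=> c b; rewrite !mxE.
apply: IH => // [|i]; first by rewrite /=; lia.
have := h (set_index i a); rewrite tt_tail_recl// (slice_ord U _ s) set_index_eq.
rewrite mulmxA => <-; congr (_ *m _); apply: eq_tt_tail => u um.
by rewrite set_index_neq//; apply: contraTneq um => <-; rewrite /= ltnn.
Qed.

Definition row_part (d : nat) (n : 'I_d -> nat) (t : nat) (i : multi_index n) :
    row_index n t := [ffun s => i (val s)].

Definition col_part (d : nat) (n : 'I_d -> nat) (t : nat) (i : multi_index n) :
    col_index n t := [ffun s => i (val s)].

Lemma join_index_lt (d : nat) (n : 'I_d -> nat) (t : nat) (a : row_index n t)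
    (b : col_index n t) (s : 'I_d) (st : (s < t)%N) :
  join_index a b s = a (exist _ s st).
Proof.
rewrite ffunE; case: {-}_ / boolP => h; first by rewrite (bool_irrelevance h st).
by exfalso; move: h; rewrite st.
Qed.

Lemma join_index_ge (d : nat) (n : 'I_d -> nat) (t : nat) (a : row_index n t)
    (b : col_index n t) (s : 'I_d) (ts : ~~ (s < t)%N) :
  join_index a b s = b (exist _ s ts).
Proof.
rewrite ffunE; case: {-}_ / boolP => h; last by rewrite (bool_irrelevance h ts).
by exfalso; move: ts; rewrite h.
Qed.

Lemma join_indexK (d : nat) (n : 'I_d -> nat) (t : nat) (i : multi_index n) :
  join_index (row_part t i) (col_part t i) = i.
Proof.
apply/ffunP => s; case: (boolP (s < t)%N) => [st|ts].
  by rewrite (join_index_lt _ _ st) ffunE.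
by rewrite (join_index_ge _ _ ts) ffunE.
Qed.

Lemma row_part_join (d : nat) (n : 'I_d -> nat) (t : nat) (a : row_index n t)
    (b : col_index n t) : row_part t (join_index a b) = a.
Proof.
by apply/ffunP => -[s st]; rewrite ffunE /= (join_index_lt _ _ st).
Qed.

Lemma col_part_join (d : nat) (n : 'I_d -> nat) (t : nat) (a : row_index n t)
    (b : col_index n t) : col_part t (join_index a b) = b.
Proof.
by apply/ffunP => -[s ts]; rewrite ffunE /= (join_index_ge _ _ ts).
Qed.

Lemma eq_join_row (d : nat) (n : 'I_d -> nat) (t : nat) (a : row_index n t)
    (b b' : col_index n t) (s : 'I_d) :
  (s < t)%N -> join_index a b s = join_index a b' s.
Proof. by move=> st; rewrite !(join_index_lt _ _ st). Qed.

Lemma eq_join_col (d : nat) (n : 'I_d -> nat) (t : nat) (a a' : row_index n t)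
    (b : col_index n t) (s : 'I_d) :
  (t <= s)%N -> join_index a b s = join_index a' b s.
Proof. by rewrite leqNgt => ts; rewrite !(join_index_ge _ _ ts). Qed.

(* The multi-index z only supplies the irrelevant modes. *)
Definition head_mx (R : realType) (d : nat) (n : 'I_d -> nat) (U : tt_fact R n)
    (z : multi_index n) (t : nat) : 'M[R]_(#|row_index n t|, rk U t) :=
  \matrix_a tt_head U (join_index (enum_val a) (col_part t z)) t.

Definition tail_mx (R : realType) (d : nat) (n : 'I_d -> nat) (U : tt_fact R n)
    (z : multi_index n) (t : nat) : 'M[R]_(rk U t, #|col_index n t|) :=
  \matrix_(c, b) tt_tail U (join_index (row_part t z) (enum_val b)) t c 0.

Lemma unfolding_TT (R : realType) (d : nat) (n : 'I_d -> nat) (U : tt_fact R n)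
    (z : multi_index n) (t : nat) : (t <= d)%N ->
  unfolding t (TT U) = head_mx U z t *m tail_mx U z t.
Proof.
move=> td; apply/matrixP => a b; rewrite mxE (TT_head_tail _ _ td) !mxE.
apply: eq_bigr => c _; rewrite !mxE; congr (_ * _).
  by congr (fun_of_matrix _ _ _); apply: eq_tt_head => u; exact: eq_join_row.
by congr (fun_of_matrix _ _ _); apply: eq_tt_tail => u; exact: eq_join_col.
Qed.

Lemma head_mx_full (R : realType) (d : nat) (n : 'I_d -> nat) (U : tt_fact R n)
    (z : multi_index n) (t : nat) : (t <= d)%N -> minimal_tt U ->
  row_full (head_mx U z t).
Proof.
move=> td min; rewrite /row_full -mxrank_tr; apply: inj_row_free => v h.
rewrite -[v]trmxK (_ : v^T = 0) ?trmx0//.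
apply: (tt_head_inj z min td) => i.
have : head_mx U z t *m v^T = 0 by rewrite -[_ *m _]trmxK trmx_mul trmxK h trmx0.
move/(congr1 (row (enum_rank (row_part t i)))); rewrite row_mul row0 rowK => <-.
congr (_ *m _); apply: eq_tt_head => u ut; rewrite enum_rankK.
by rewrite -{1}(join_indexK t i); exact: eq_join_row.
Qed.

Lemma tail_mx_free (R : realType) (d : nat) (n : 'I_d -> nat) (U : tt_fact R n)
    (z : multi_index n) (t : nat) : (t <= d)%N -> minimal_tt U ->
  row_free (tail_mx U z t).
Proof.
move=> td min; apply: inj_row_free => v h.
apply: (tt_tail_inj z min td) => i; apply/matrixP => a b.
move/matrixP: h => /(_ a (enum_rank (col_part t i))); rewrite !mxE => /(etrans _); apply.
apply: eq_bigr => c _; rewrite !mxE (ord1 b); congr (_ * fun_of_matrix _ _ _).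
apply: eq_tt_tail => u ut; rewrite enum_rankK.
by rewrite -{1}(join_indexK t i); exact: eq_join_col.
Qed.

(** The unfolding factors through the bond with both factors of full rank, so all minimal
    factorizations of a tensor have equal ranks. *)
Lemma minimal_rank (R : realType) (d : nat) (n : 'I_d -> nat) (U : tt_fact R n)
    (z : multi_index n) (t : nat) : (t <= d)%N -> minimal_tt U ->
  \rank (unfolding t (TT U)) = rk U t.
Proof.
move=> td min; rewrite (unfolding_TT _ z td) mxrankMfree ?tail_mx_free//.
by apply/eqP; exact: head_mx_full.
Qed.

Lemma rank_unfolding_le (R : realType) (d : nat) (n : 'I_d -> nat)
    (U : tt_fact R n) (z : multi_index n) (t : nat) : (t <= d)%N ->
  (\rank (unfolding t (TT U)) <= rk U t)%N.
Proof.
move=> td; rewrite (unfolding_TT _ z td); apply: leq_trans (mxrankM_maxl _ _) _.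
exact: rank_leq_col.
Qed.

Lemma tensor_neq0 (R : realType) (d : nat) (n : 'I_d -> nat) (A : tensor R n) :
  A != 0 -> exists z, A z != 0.
Proof.
move=> A0; apply/existsP; apply: contraR A0 => /existsPn h; apply/eqP/ffunP => i.
by rewrite ffunE; apply/eqP; rewrite -[_ == _]negbK h.
Qed.

(** The ranks of the unfoldings are lower bounds for every factorization, and a minimal one attains
    them all at once. For the zero tensor the ranks are 1, the least positive value. *)
Lemma exists_tt_rank (R : realType) (d : nat) (n : 'I_d -> nat)
    (U : tt_fact R n) : (0 < d)%N -> exists l, is_tt_rank (TT U) l.
Proof.
move=> d0; have [U0|U0] := eqVneq (TT U) 0.
  exists (fun=> 1%N); rewrite U0; split; last first.
    by move=> U' _ s /andP[_ sd]; apply: rk_gt0; exact: ltnW.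
  pose Z := @TTFact R d n (fun=> 1%N) (fun s i => 0) erefl erefl (fun s _ => isT).
  by exists Z => //; exact: (@TT_core0 _ _ _ Z (Ordinal d0)).
have [z _] := tensor_neq0 U0.
have [U' [e min _]] := exists_left_orthogonal U0.
exists (rk U'); split; first by exists U'.
move=> U'' e'' s /andP[_ sd].
rewrite -(minimal_rank z (ltnW sd) min) e -e''.
exact: (rank_unfolding_le U'' z (ltnW sd)).
Qed.

(** * Orthonormality of the interfaces *)

(** Freezing the modes in D at the values of [z] expresses a sum over part of the modes as a sum
    over full multi-indices. *)
Definition agree (d : nat) (n : 'I_d -> nat) (z : multi_index n) (D : pred 'I_d)
    (i : multi_index n) : bool :=
  [forall u, D u ==> (i u == z u)].

Lemma agreeP (d : nat) (n : 'I_d -> nat) (z : multi_index n) (D : pred 'I_d)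
    (i : multi_index n) :
  reflect (forall u, D u -> i u = z u) (agree z D i).
Proof.
apply: (iffP forallP) => [h u Du|h u]; first by apply/eqP; move: (h u); rewrite Du.
by apply/implyP => /h ->.
Qed.

Lemma sum_agree_set (V : nmodType) (d : nat) (n : 'I_d -> nat)
    (z : multi_index n) (D : pred 'I_d) (s : 'I_d) (f : multi_index n -> V) :
  D s ->
  \sum_(i | agree z [pred u | D u & u != s] i) f i =
  \sum_(i | agree z D i) \sum_a f (set_index (s := s) i a).
Proof.
move=> Ds; rewrite pair_big_dep /=.
rewrite (reindex_onto (fun v : multi_index n * 'I_(n s) => set_index v.1 v.2)
  (fun v => (set_index v (z s), v s))) /=; last first.
  move=> v _; apply/ffunP => u; have [<-|su] := eqVneq s u.
    by rewrite set_index_eq.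
  by rewrite !set_index_neq.
apply: eq_bigl => -[i a] /=; rewrite andbT set_index_eq.
have -> : ((set_index (set_index i a) (z s), a) == (i, a)) = (i s == z s).
  rewrite xpair_eqE eqxx andbT; apply/eqP/eqP => [<-|e]; first by rewrite set_index_eq.
  apply/ffunP => u; have [<-|su] := eqVneq s u; first by rewrite set_index_eq.
  by rewrite !set_index_neq.
apply/andP/agreeP => [[/agreeP h /eqP e] u Du|h].
  have [<-//|su] := eqVneq s u; rewrite -h ?set_index_neq//=.
  by rewrite Du eq_sym.
split; last by rewrite h.
apply/agreeP => u /andP[Du us]; rewrite set_index_neq ?h//.
by rewrite eq_sym.
Qed.

Lemma left_unfolding_gram (R : realType) (p n q : nat) (G : core3 R p n q) :
  (left_unfolding G)^T *m left_unfolding G = \sum_i (G i)^T *m G i.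
Proof.
apply/matrixP => a b; rewrite summxE mxE.
rewrite (reindex _ (curry_mxvec_bij _ _)) /=.
rewrite (eq_bigr (fun j : 'I_n * 'I_p => G j.1 j.2 a * G j.1 j.2 b)).
  rewrite -(pair_bigA _ (fun i c => G i c a * G i c b)) /=.
  by apply: eq_bigr => i _; rewrite mxE; apply: eq_bigr => c _; rewrite mxE.
by move=> [i c] _; rewrite mxE !left_unfoldingE.
Qed.

Lemma right_unfolding_gram (R : realType) (p n q : nat) (G : core3 R p n q) :
  right_unfolding G *m (right_unfolding G)^T = \sum_i G i *m (G i)^T.
Proof.
apply/matrixP => a b; rewrite summxE mxE.
rewrite (reindex _ (curry_mxvec_bij _ _)) /=.
rewrite (eq_bigr (fun j : 'I_n * 'I_q => G j.1 a j.2 * G j.1 b j.2)).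
  rewrite -(pair_bigA _ (fun i c => G i a c * G i b c)) /=.
  by apply: eq_bigr => i _; rewrite mxE; apply: eq_bigr => c _; rewrite mxE.
by move=> [i c] _; rewrite [X in _ * X]mxE !right_unfoldingE.
Qed.

Lemma const1_gram_l (R : realType) (p : nat) : p = 1%N ->
  (const_mx 1 : 'rV[R]_p)^T *m (const_mx 1 : 'rV[R]_p) = 1%:M.
Proof.
move=> ->; apply/matrixP => a b.
by rewrite !mxE big_ord1 !mxE mulr1 (ord1 a) (ord1 b).
Qed.

Lemma const1_gram_r (R : realType) (p : nat) : p = 1%N ->
  (const_mx 1 : 'cV[R]_p) *m (const_mx 1 : 'cV[R]_p)^T = 1%:M.
Proof.
move=> ->; apply/matrixP => a b.
by rewrite !mxE big_ord1 !mxE mulr1 (ord1 a) (ord1 b).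
Qed.

(** The sum over the earlier modes is the identity by induction, and what remains is the Gram matrix
    of the left unfolding of the next core. The bound m < d keeps the last core out, as it need not
    be left-orthogonal. *)
Lemma sum_tt_head_gram (R : realType) (d : nat) (n : 'I_d -> nat)
    (U : tt_fact R n) (z : multi_index n) (m : nat) :
  left_orthogonal_tt U -> (m < d)%N ->
  \sum_(i | agree z [pred u : 'I_d | (m <= u)%N] i)
    (tt_head U i m)^T *m tt_head U i m = 1%:M.
Proof.
move=> lo; elim: m => [|m IH] md.
  rewrite (big_pred1 z) /= => [|i]; first by rewrite const1_gram_l ?rk_first.
  apply/agreeP/eqP => [h|-> //]; apply/ffunP => u; exact: h.
pose s := Ordinal (ltnW md).
rewrite (eq_bigl (agree z [pred u : 'I_d | (m <= u)%N & u != s])); last first.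
  move=> i; apply: eq_forallb => u /=; congr (_ ==> _).
  by rewrite ltn_neqAle andbC; congr (_ && _); rewrite -val_eqE /= eq_sym.
rewrite (@sum_agree_set _ _ _ z [pred u : 'I_d | (m <= u)%N] s) /=;
  last exact: leqnn.
rewrite exchange_big /=.
rewrite -[RHS](lo s md) left_unfolding_gram; apply: eq_bigr => a _.
rewrite (eq_bigr (fun i => (core U s a)^T *m
  ((tt_head U i m)^T *m tt_head U i m) *m core U s a)).
  by rewrite -mulmx_suml -mulmx_sumr IH ?mulmx1 // ltnW.
move=> i _; rewrite (slice_ord U _ s) set_index_eq trmx_mul !mulmxA.
rewrite (@eq_tt_head _ _ _ U (set_index (s := s) i a) i) // => u um.
by rewrite set_index_neq//; apply: contraTneq um => <-; rewrite /= ltnn.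
Qed.

Lemma sum_tt_tail_gram (R : realType) (d : nat) (n : 'I_d -> nat)
    (U : tt_fact R n) (z : multi_index n) (m : nat) :
  right_orthogonal_tt U -> (0 < m <= d)%N ->
  \sum_(i | agree z [pred u : 'I_d | (u < m)%N] i)
    tt_tail U i m *m (tt_tail U i m)^T = 1%:M.
Proof.
move=> ro /andP[m0 md]; have [k km] : exists k, (k + m = d)%N.
  by exists (d - m)%N; rewrite subnK.
elim: k m m0 {md} km => [|k IH] m m0.
  rewrite add0n => ->; rewrite (big_pred1 z) /= => [|i].
    by rewrite tt_tail_last const1_gram_r ?rk_last.
  by apply/agreeP/eqP => [h|-> //]; apply/ffunP => u; apply: h; rewrite /=.
move=> km; have md : (m < d)%N by lia.
pose s := Ordinal md.
rewrite (eq_bigl (agree z [pred u : 'I_d | (u < m.+1)%N & u != s])); last first.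
  move=> i; apply: eq_forallb => u /=; congr (_ ==> _).
  by rewrite ltnS ltn_neqAle andbC; congr (_ && _); rewrite -val_eqE.
rewrite (@sum_agree_set _ _ _ z [pred u : 'I_d | (u < m.+1)%N] s) /=;
  last exact: leqnn.
rewrite exchange_big /=.
rewrite -[RHS](ro s m0) right_unfolding_gram; apply: eq_bigr => a _.
rewrite (eq_bigr (fun i => core U s a *m
  (tt_tail U i m.+1 *m (tt_tail U i m.+1)^T) *m (core U s a)^T)).
  rewrite -mulmx_suml -mulmx_sumr (IH m.+1) ?mulmx1 //; lia.
move=> i _; rewrite tt_tail_recl// (slice_ord U _ s) set_index_eq trmx_mul !mulmxA.
rewrite (@eq_tt_tail _ _ _ U (set_index (s := s) i a) i) // => u um.
by rewrite set_index_neq//; apply: contraTneq um => <-; rewrite /= ltnn.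
Qed.

Lemma head_mx_orthonormal (R : realType) (d : nat) (n : 'I_d -> nat)
    (U : tt_fact R n) (z : multi_index n) (t : nat) :
  left_orthogonal_tt U -> (t < d)%N ->
  (head_mx U z t)^T *m head_mx U z t = 1%:M.
Proof.
move=> lo td; rewrite -(sum_tt_head_gram z lo td).
rewrite (reindex_onto (fun a => join_index a (col_part t z)) (row_part t)) /=.
  rewrite (eq_bigl xpredT) => [|a].
    rewrite (reindex _ (onW_bij _ (enum_val_bij (row_index n t)))) /=.
    apply/matrixP => b c; rewrite summxE mxE; apply: eq_bigr => a _.
    by rewrite !mxE big_ord1 !mxE.
  rewrite row_part_join eqxx andbT; apply/agreeP => u /= tu.
  by rewrite -{2}(join_indexK t z); exact: eq_join_col.
move=> i /agreeP h; apply/ffunP => u; have [ut|tu] := ltnP u t.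
  by rewrite -{2}(join_indexK t i); exact: eq_join_row.
by rewrite h// -{2}(join_indexK t z); exact: eq_join_col.
Qed.

Lemma tail_mx_orthonormal (R : realType) (d : nat) (n : 'I_d -> nat)
    (U : tt_fact R n) (z : multi_index n) (t : nat) :
  right_orthogonal_tt U -> (0 < t <= d)%N ->
  tail_mx U z t *m (tail_mx U z t)^T = 1%:M.
Proof.
move=> ro td; rewrite -(sum_tt_tail_gram z ro td).
rewrite (reindex_onto (fun a => join_index (row_part t z) a) (col_part t)) /=.
  rewrite (eq_bigl xpredT) => [|a].
    rewrite (reindex _ (onW_bij _ (enum_val_bij (col_index n t)))) /=.
    apply/matrixP => b c; rewrite summxE mxE; apply: eq_bigr => a _.
    by rewrite !mxE big_ord1 !mxE.
  rewrite col_part_join eqxx andbT; apply/agreeP => u /= tu.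
  by rewrite -{2}(join_indexK t z); exact: eq_join_row.
move=> i /agreeP h; apply/ffunP => u; have [ut|tu] := ltnP u t.
  by rewrite h// -{2}(join_indexK t z); exact: eq_join_row.
by rewrite -{2}(join_indexK t i); exact: eq_join_col.
Qed.

(** * Coherences *)

(** The Frobenius norm bounds the set, so the supremum is a genuine one; scaling x to the unit
    sphere gives the estimate. *)
Lemma spectral_norm_bound (R : realType) (m n : nat) (M : 'M[R]_(m, n)) :
  0 <= spectral_norm M /\
  forall x : 'cV[R]_n, sqfrob (M *m x) <= spectral_norm M ^+ 2 * sqfrob x.
Proof.
set E := [set frobenius_norm (M *m x) | x in
  [set x : 'cV[R]_n | frobenius_norm x <= 1]]%classic.
have ubE : has_ubound E.
  exists (frobenius_norm M) => _ [x /= x1 <-].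
  apply: le_trans (frobenius_mul_le _ _) _.
  by rewrite ler_piMr ?frobenius_ge0.
have f0 p q : frobenius_norm (0 : 'M[R]_(p, q)) = 0.
  by rewrite /frobenius_norm -/(sqfrob _) sqfrob0 sqrtr0.
have s0 : 0 <= spectral_norm M.
  apply: (ub_le_sup ubE); by exists 0; rewrite /= ?mulmx0 f0 ?ler01.
split; first exact: s0.
move=> x; have [->|x0] := eqVneq x 0; first by rewrite mulmx0 !sqfrob0 mulr0.
have fx : 0 < frobenius_norm x.
  by rewrite lt_neqAle frobenius_ge0 eq_sym -sqrf_eq0 sqr_frobenius sqfrob_eq0 x0.
have : frobenius_norm (M *m ((frobenius_norm x)^-1 *: x)) <= spectral_norm M.
  apply: (ub_le_sup ubE); exists ((frobenius_norm x)^-1 *: x) => //=.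
  rewrite -(@ler_pXn2r _ 2) ?nnegrE ?frobenius_ge0//.
  rewrite sqr_frobenius sqfrobZ -sqr_frobenius -exprMn mulVf ?expr1n//.
  by rewrite gt_eqF.
rewrite -(@ler_pXn2r _ 2) ?nnegrE ?frobenius_ge0// sqr_frobenius.
rewrite -scalemxAr sqfrobZ exprVn sqr_frobenius mulrC ler_pdivrMr//.
by rewrite -sqr_frobenius exprn_gt0.
Qed.

Lemma sqfrob_mul_spectral (R : realType) (m n p : nat) (M : 'M[R]_(m, n))
    (N : 'M[R]_(n, p)) :
  sqfrob (M *m N) <= spectral_norm M ^+ 2 * sqfrob N.
Proof.
rewrite -(sqfrob_tr N) -sqfrob_tr !(sqfrob_row (_^T)) mulr_sumr.
apply: ler_sum => j _; rewrite -!tr_col !sqfrob_tr.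
have -> : col j (M *m N) = M *m col j N by rewrite colE -mulmxA -colE.
exact: (proj2 (spectral_norm_bound M)).
Qed.

Lemma sqfrob_trE (R : realType) (m n : nat) (M : 'M[R]_(m, n)) :
  sqfrob M = \tr (M^T *m M).
Proof. by rewrite -sqfrob_tr sqfrobE trmxK. Qed.

Lemma sqfrob_isometry (R : realType) (m n p : nat) (H : 'M[R]_(m, n))
    (Y : 'M[R]_(n, p)) : H^T *m H = 1%:M -> sqfrob (H *m Y) = sqfrob Y.
Proof.
by move=> HH; rewrite !sqfrob_trE trmx_mul -mulmxA (mulmxA H^T) HH mul1mx.
Qed.

(** Pythagoras: the difference is the squared norm of Y - H H^T Y. *)
Lemma sqfrob_coisometry (R : realType) (m n p : nat) (H : 'M[R]_(m, n))
    (Y : 'M[R]_(m, p)) : H^T *m H = 1%:M -> sqfrob (H^T *m Y) <= sqfrob Y.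
Proof.
move=> HH; rewrite -subr_ge0.
suff -> : sqfrob Y - sqfrob (H^T *m Y) = sqfrob (Y - H *m (H^T *m Y)).
  exact: sqfrob_ge0.
set P := H^T *m Y; rewrite [RHS]sqfrob_trE [(Y - _)^T]linearB /= mulmxBl !mulmxBr.
have -> : Y^T *m (H *m P) = P^T *m P by rewrite mulmxA trmx_mul trmxK.
have -> : (H *m P)^T *m Y = P^T *m P by rewrite trmx_mul -mulmxA.
have -> : (H *m P)^T *m (H *m P) = P^T *m P.
  by rewrite trmx_mul -mulmxA (mulmxA H^T) HH mul1mx.
by rewrite subrr subr0 linearB /= -!sqfrob_trE.
Qed.

(** Both sides are the orthogonal projection onto the common row space. *)
Lemma orthonormal_gram_eq (R : realType) (k l m : nat) (M : 'M[R]_(k, m))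
    (N : 'M[R]_(l, m)) : M *m M^T = 1%:M -> N *m N^T = 1%:M ->
  (M :=: N)%MS -> M^T *m M = N^T *m N.
Proof.
move=> MM NN eqMN.
have /submxP[A EA] : (M <= N)%MS by rewrite eqMN.
have /submxP[B EB] : (N <= M)%MS by rewrite eqMN.
have h1 : M *m (N^T *m N) = M by rewrite EA -mulmxA (mulmxA N) NN mul1mx.
have h2 : N *m (M^T *m M) = N by rewrite EB -mulmxA (mulmxA M) MM mul1mx.
have h3 : (M^T *m M) *m N^T = N^T.
  by have := congr1 trmx h2; rewrite !trmx_mul !trmxK.
by rewrite -[X in M^T *m X]h1 !mulmxA h3.
Qed.

Lemma orthonormal_basisP (R : realType) (k m : nat) (M : 'M[R]_(k, m)) :
  (orthonormal_basis M)^T *m orthonormal_basis M = 1%:M /\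
  ((orthonormal_basis M)^T :=: M)%MS.
Proof.
rewrite /orthonormal_basis; set P := (X in xget _ X).
suff /(xgetPex 0)[h1 h2] : exists Q, P Q by split=> //; exact/eqmxP.
have [Q [QQ eqQ]] := gram_schmidt (row_base_free M).
exists Q^T; rewrite /P /= trmxK; split=> //; apply/eqmxP.
exact: eqmx_trans eqQ (eq_row_base M).
Qed.

(** The block norms depend only on the orthogonal projection, so the rows of M can replace the basis
    picked by choice. *)
Lemma block_coherence_orthonormal (R : realType) (k n p : nat)
    (M : 'M[R]_(k, n * p)) : M *m M^T = 1%:M ->
  block_coherence M = (n * p)%:R / k%:R *
    \big[Num.max/0]_(i < n) sqfrob (M *m block_cols R p i).
Proof.
move=> MM; rewrite /block_coherence.
have rkM : \rank M = k.
  apply/eqP; rewrite eqn_leq rank_leq_row /=.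
  by apply: leq_trans (mxrankM_maxl M M^T); rewrite MM mxrank1.
congr (_ / _ * _); first by rewrite rkM.
apply: eq_bigr => i _; rewrite sqr_frobenius.
have [QQ eqQ] := orthonormal_basisP M.
rewrite !sqfrob_trE !trmx_mul trmxK -!mulmxA; congr (\tr (_ *m _)).
rewrite !mulmxA; congr (_ *m _).
rewrite -[X in X *m _]trmxK; apply: orthonormal_gram_eq => //.
by rewrite trmxK.
Qed.

Lemma mulmx_block_cols (R : realType) (k n p : nat) (M : 'M[R]_(k, n * p))
    (i : 'I_n) :
  M *m block_cols R p i = \matrix_(a, b) M a (mxvec_index i b).
Proof.
apply/matrixP => a b; rewrite !mxE (bigD1 (mxvec_index i b)) //= mxE eqxx mulr1.
by rewrite big1 ?addr0// => c /negPf cb; rewrite mxE cb mulr0.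
Qed.

Lemma left_coherence_orthogonal (R : realType) (p n q : nat)
    (G : core3 R p n q) : left_orthogonal G ->
  left_coherence G =
    (n * p)%:R / q%:R * \big[Num.max/0]_(i < n) sqfrob (G i).
Proof.
move=> lo; rewrite /left_coherence block_coherence_orthonormal ?trmxK//.
congr (_ * _); apply: eq_bigr => i _; rewrite -(sqfrob_tr (G i)).
congr sqfrob; apply/matrixP => a b.
by rewrite mulmx_block_cols mxE [LHS]mxE left_unfoldingE mxE.
Qed.

Lemma right_coherence_orthogonal (R : realType) (p n q : nat)
    (G : core3 R p n q) : right_orthogonal G ->
  right_coherence G =
    (n * q)%:R / p%:R * \big[Num.max/0]_(i < n) sqfrob (G i).
Proof.
move=> ro; rewrite /right_coherence block_coherence_orthonormal//.
congr (_ * _); apply: eq_bigr => i _.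
congr sqfrob; apply/matrixP => a b.
by rewrite mulmx_block_cols mxE right_unfoldingE.
Qed.

(** * Products of coherences and slice norms *)

Lemma prod_ord_ltS (R : comPzRingType) (d t : nat) (td : (t < d)%N)
    (F : 'I_d -> R) :
  \prod_(s < d | (s < t.+1)%N) F s =
  (\prod_(s < d | (s < t)%N) F s) * F (Ordinal td).
Proof.
rewrite (bigD1 (Ordinal td)) //= mulrC; congr (_ * _).
apply: eq_bigl => s; rewrite ltnS ltn_neqAle andbC.
by rewrite -val_eqE.
Qed.

Lemma prod_ord_ge (R : comPzRingType) (d t : nat) (td : (t < d)%N)
    (F : 'I_d -> R) :
  \prod_(s < d | (t <= s)%N) F s =
  F (Ordinal td) * \prod_(s < d | (t < s)%N) F s.
Proof.
rewrite (bigD1 (Ordinal td)) //=; congr (_ * _).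
apply: eq_bigl => s; rewrite [in RHS]ltn_neqAle andbC.
by rewrite -val_eqE /= eq_sym.
Qed.

(** The factor of mode s carries the ratio of its left rank to its right rank; these telescope to 1
    / [rk U t] because the boundary rank is 1. *)
Lemma prod_left_coherence (R : realType) (d : nat) (n : 'I_d -> nat)
    (U : tt_fact R n) (t : nat) : left_orthogonal_tt U -> (t < d)%N ->
  (rk U t)%:R * \prod_(s < d | (s < t)%N) left_coherence (core U s) =
  (\prod_(s < d | (s < t)%N) (n s)%:R) *
  \prod_(s < d | (s < t)%N) \big[Num.max/0]_(i < n s) sqfrob (core U s i).
Proof.
move=> lo; elim: t => [|t IH] td.
  by rewrite !big_pred0_eq !mulr1 rk_first.
pose s := Ordinal (ltnW td); rewrite !(prod_ord_ltS (ltnW td)).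
rewrite -/s left_coherence_orthogonal; last exact: (lo s).
have r0 : (rk U t.+1)%:R != 0 :> R by rewrite pnatr_eq0 -lt0n rk_gt0// ltnW.
have {}IH := IH (ltnW td); rewrite [RHS]mulrACA -IH natrM /=.
by field.
Qed.

Lemma prod_right_coherence (R : realType) (d : nat) (n : 'I_d -> nat)
    (U : tt_fact R n) (t : nat) : right_orthogonal_tt U -> (0 < t <= d)%N ->
  (rk U t)%:R * \prod_(s < d | (t <= s)%N) right_coherence (core U s) =
  (\prod_(s < d | (t <= s)%N) (n s)%:R) *
  \prod_(s < d | (t <= s)%N) \big[Num.max/0]_(i < n s) sqfrob (core U s i).
Proof.
move=> ro /andP[t0 td]; have [k km] : exists k, (k + t = d)%N.
  by exists (d - t)%N; rewrite subnK.
elim: k t t0 {td} km => [|k IH] t t0.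
  rewrite add0n => ->.
  by rewrite !big_pred0 ?mulr1 ?rk_last // => s; rewrite leqNgt ltn_ord.
move=> km; have td : (t < d)%N by lia.
pose s := Ordinal td; rewrite !(prod_ord_ge td).
rewrite -/s right_coherence_orthogonal; last exact: (ro s).
have r0 : (rk U t)%:R != 0 :> R by rewrite pnatr_eq0 -lt0n rk_gt0// ltnW.
have {}IH : _ = _ := IH t.+1 isT _; rewrite [RHS]mulrACA -IH; last by lia.
by rewrite natrM /=; field.
Qed.

Lemma prod_slice_head_le (R : realType) (d : nat) (n : 'I_d -> nat)
    (U : tt_fact R n) (i : multi_index n) (t : nat) : (t <= d)%N ->
  \prod_(0 <= s < t) frobenius_norm (slice U i s) <=
  Num.sqrt (\prod_(s < d | (s < t)%N)
    \big[Num.max/0]_(a < n s) sqfrob (core U s a)).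
Proof.
move=> td; rewrite big_mkord
  (big_ord_widen _ (fun s => frobenius_norm (slice U i s)) td).
rewrite -[leLHS]ger0_norm; last by apply: prodr_ge0 => s _; exact: frobenius_ge0.
rewrite -sqrtr_sqr ler_sqrt; last first.
  by apply: prodr_ge0 => s _; exact: bigmax_ge_id.
rewrite -prodrXl; apply: ler_prod => s _.
rewrite sqr_ge0 /= sqr_frobenius slice_ord.
exact: (le_bigmax _ (fun a => sqfrob (core U s a))).
Qed.

Lemma prod_slice_tail_le (R : realType) (d : nat) (n : 'I_d -> nat)
    (U : tt_fact R n) (i : multi_index n) (t : nat) :
  \prod_(t <= s < d) frobenius_norm (slice U i s) <=
  Num.sqrt (\prod_(s < d | (t <= s)%N)
    \big[Num.max/0]_(a < n s) sqfrob (core U s a)).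
Proof.
rewrite big_geq_mkord /=.
rewrite -[leLHS]ger0_norm; last by apply: prodr_ge0 => s _; exact: frobenius_ge0.
rewrite -sqrtr_sqr ler_sqrt; last first.
  by apply: prodr_ge0 => s _; exact: bigmax_ge_id.
rewrite -prodrXl; apply: ler_prod => s _.
rewrite sqr_ge0 /= sqr_frobenius slice_ord.
exact: (le_bigmax _ (fun a => sqfrob (core U s a))).
Qed.

(* The matrix S between the orthonormal interfaces of U and V is a compression
   of the unfolding, hence its spectral norm is not larger. *)
Lemma exists_mixed_factorization (R : realType) (d : nat) (n : 'I_d -> nat)
    (A : tensor R n) (U V : tt_fact R n) (z : multi_index n) (t : nat) :
  (0 < t < d)%N -> TT U = A -> TT V = A ->
  left_orthogonal_tt U -> right_orthogonal_tt V ->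
  exists2 H : tt_fact R n, TT H = A & forall i, core_norms H i <=
    Num.sqrt (\prod_(s < d | (s < t)%N)
      \big[Num.max/0]_(a < n s) sqfrob (core U s a)) *
    Num.sqrt (\prod_(s < d | (t <= s)%N)
      \big[Num.max/0]_(a < n s) sqfrob (core V s a)) *
    spectral_norm (unfolding t A).
Proof.
case: t => [//|t] /= td eU eV lo ro.
pose o := Ordinal (ltnW td); have od : (o.+1 < d)%N by [].
have hU := head_mx_orthonormal z lo td.
have td' : (0 < t.+1 <= d)%N by apply: ltnW.
have hV := tail_mx_orthonormal z ro td'.
pose S := (head_mx U z o.+1)^T *m unfolding t.+1 A *m (tail_mx V z o.+1)^T.
(* Compression loses nothing: U and V both represent A, so the interfaces project onto spaces
   containing the columns and the rows of the unfolding. *)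
have ES : unfolding t.+1 A = head_mx U z t.+1 *m S *m tail_mx V z t.+1.
  rewrite /S !mulmxA -[in RHS]eU (unfolding_TT U z (ltnW td)).
  rewrite -[_ *m (_^T) *m (_ *m _)]mulmxA (mulmxA (_^T)) hU mul1mx.
  rewrite -(unfolding_TT U z (ltnW td)) eU -eV (unfolding_TT V z (ltnW td)).
  by rewrite -!mulmxA (mulmxA (tail_mx _ _ _)) hV mul1mx.
have q0 : (0 < rk U o.+1)%N by apply: rk_gt0; exact: ltnW.
exists (tt_glue od q0 1%:M S) => [|i].
  apply/ffunP => i; rewrite TT_glue mul1mx.
  rewrite -[in RHS](join_indexK t.+1 i).
  have -> : A (join_index (row_part t.+1 i) (col_part t.+1 i)) =
      unfolding t.+1 A (enum_rank (row_part t.+1 i)) (enum_rank (col_part t.+1 i)).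
    by rewrite mxE !enum_rankK.
  rewrite ES [LHS]mxE [RHS]mxE; apply: eq_bigr => c _; congr (_ * _); last first.
    rewrite [RHS]mxE; congr (fun_of_matrix _ _ _); apply: eq_tt_tail => u ut.
    by rewrite enum_rankK -{1}(join_indexK t.+1 i); exact: eq_join_col.
  rewrite [LHS]mxE [RHS]mxE; apply: eq_bigr => b _; congr (_ * _).
  rewrite [RHS]mxE; congr (fun_of_matrix _ _ _); apply: eq_tt_head => u ut.
  by rewrite enum_rankK -{1}(join_indexK t.+1 i); exact: eq_join_row.
have sig := spectral_norm_bound (unfolding t.+1 A).
(* S is absorbed by the first core taken from V. The two orthonormal interfaces do not increase the
   Frobenius norm, so the cost is one spectral norm. *)
have hS : frobenius_norm (S *m slice V i o.+1) <=
    spectral_norm (unfolding t.+1 A) * frobenius_norm (slice V i o.+1).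
  rewrite -(@ler_pXn2r _ 2) ?nnegrE ?mulr_ge0 ?frobenius_ge0 ?(proj1 sig)//.
  rewrite exprMn !sqr_frobenius /S -!mulmxA.
  apply: le_trans (sqfrob_coisometry _ hU) _.
  apply: le_trans (sqfrob_mul_spectral _ _) _.
  by rewrite sqfrob_isometry ?trmxK.
rewrite core_norms_glue mulmx1.
apply: (@le_trans _ _ (\prod_(0 <= s < t.+1) frobenius_norm (slice U i s) *
  \prod_(t.+1 <= s < d) frobenius_norm (slice V i s) *
  spectral_norm (unfolding t.+1 A))).
  rewrite big_nat_recr //= [\prod_(t.+1 <= _ < d) _]big_ltn//.
  rewrite -!mulrA ler_wpM2l ?prodr_ge0// => [s _|]; first exact: frobenius_ge0.
  rewrite ler_wpM2l ?frobenius_ge0//.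
  rewrite [leRHS](_ : _ = spectral_norm (unfolding t.+1 A) *
    frobenius_norm (slice V i o.+1) *
    \prod_(t.+2 <= s < d) frobenius_norm (slice V i s)); last by ring.
  by rewrite ler_wpM2r ?prodr_ge0// => s _; exact: frobenius_ge0.
rewrite ler_wpM2r ?(proj1 sig)//; apply: ler_pM.
- by apply: prodr_ge0 => s _; exact: frobenius_ge0.
- by apply: prodr_ge0 => s _; exact: frobenius_ge0.
- exact/prod_slice_head_le/ltnW.
- exact: prod_slice_tail_le.
Qed.

(** The set behind [xget] is nonempty, so the chosen coherences come from an actual factorization,
    which the mixed factorization can then use. *)
Lemma left_core_coherenceP (R : realType) (d : nat) (n : 'I_d -> nat)
    (U : tt_fact R n) : TT U != 0 ->
  exists U', [/\ TT U' = TT U, minimal_tt U', left_orthogonal_tt U' &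
    left_core_coherence (TT U) = [ffun s => left_coherence (core U' s)]].
Proof.
move=> U0; rewrite /left_core_coherence; set P := (X in xget _ X).
suff /(xgetPex 0)[U' [e min lo E]] : exists mu, P mu by exists U'.
have [U' [e min lo]] := exists_left_orthogonal U0.
by exists [ffun s => left_coherence (core U' s)], U'.
Qed.

Lemma right_core_coherenceP (R : realType) (d : nat) (n : 'I_d -> nat)
    (U : tt_fact R n) : TT U != 0 ->
  exists U', [/\ TT U' = TT U, minimal_tt U', right_orthogonal_tt U' &
    right_core_coherence (TT U) = [ffun s => right_coherence (core U' s)]].
Proof.
move=> U0; rewrite /right_core_coherence; set P := (X in xget _ X).
suff /(xgetPex 0)[U' [e min lo E]] : exists mu, P mu by exists U'.
have [U' [e min lo]] := exists_right_orthogonal U0.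
by exists [ffun s => right_coherence (core U' s)], U'.
Qed.

Lemma exists_tt_bound_factorization (R : realType) (d : nat) (n : 'I_d -> nat)
    (A : tensor R n) (k : nat -> nat) (t : nat) :
  (0 < t < d)%N -> A != 0 -> is_tt_rank A k ->
  exists2 H : tt_fact R n, TT H = A & forall i,
    Num.sqrt (\prod_(s < d) (n s)%:R) * core_norms H i <= tt_bound A k t.
Proof.
move=> td A0 [[W eW rkW] _]; have [z _] := tensor_neq0 A0.
have W0 : TT W != 0 by rewrite eW.
have td' : (t <= d)%N by case/andP: td => _ /ltnW.
have [U [eU minU lo EU]] := left_core_coherenceP W0.
have [V [eV minV ro EV]] := right_core_coherenceP W0.
rewrite eW in eU eV EU EV.
have [H eH hH] := exists_mixed_factorization z td eU eV lo ro.
exists H => // i.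
have rkUV : rk V t = rk U t.
  by rewrite -(minimal_rank z td' minV) -(minimal_rank z td' minU) eU eV.
(* [W] realises the TT rank [k], and its rank at t is at least that of the unfolding, which equals
   [rk U t]. *)
have rk_le : (rk U t <= k t)%N.
  rewrite -(minimal_rank z td' minU) eU -eW -(rkW _ td).
  exact: rank_unfolding_le.
have [s0 _] := spectral_norm_bound (unfolding t A).
have [t0 td1] := andP td.
have eL := prod_left_coherence lo td1.
have tdr : (0 < t <= d)%N by rewrite t0.
have eR := prod_right_coherence ro tdr; rewrite rkUV in eR.
rewrite /tt_bound EU EV.
have -> : \prod_(s < d | (s < t)%N) [ffun s => left_coherence (core U s)] s =
    \prod_(s < d | (s < t)%N) left_coherence (core U s).
  by apply: eq_bigr => s _; rewrite ffunE.
have -> : \prod_(s < d | (t <= s)%N) [ffun s => right_coherence (core V s)] s =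
    \prod_(s < d | (t <= s)%N) right_coherence (core V s).
  by apply: eq_bigr => s _; rewrite ffunE.
set Pl := \prod_(s < d | _) left_coherence _ in eL *.
set Pr := \prod_(s < d | _) right_coherence _ in eR *.
move: (hH i); set ml := \prod_(s < d | (s < t)%N) \big[_/_]_(_ < _) _ in eL *.
set mr := \prod_(s < d | (t <= s)%N) \big[_/_]_(_ < _) _ in eR *.
set sg := spectral_norm _ in s0 * => hi.
have -> : \prod_(s < d) (n s)%:R = (\prod_(s < d | (s < t)%N) (n s)%:R) *
    (\prod_(s < d | (t <= s)%N) (n s)%:R) :> R.
  rewrite (bigID (fun s : 'I_d => (s < t)%N)) /=; congr (_ * _).
  by apply: eq_bigl => s; rewrite -leqNgt.
set Nl := \prod_(s < d | (s < t)%N) _%:R in eL *.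
set Nr := \prod_(s < d | (t <= s)%N) _%:R in eR *.
have Nl0 : 0 <= Nl by apply: prodr_ge0.
have Nr0 : 0 <= Nr by apply: prodr_ge0.
have rho0 : 0 <= (rk U t)%:R :> R by [].
(* One sqrt of [rk U t] comes from each side, which accounts for the rank factor of the bound. *)
have key : (rk U t)%:R * (Num.sqrt Pl * Num.sqrt Pr) =
    Num.sqrt (Nl * Nr) * (Num.sqrt ml * Num.sqrt mr).
  have : Num.sqrt ((rk U t)%:R * Pl) * Num.sqrt ((rk U t)%:R * Pr) =
      Num.sqrt (Nl * ml) * Num.sqrt (Nr * mr) by rewrite eL eR.
  rewrite !sqrtrM// mulrACA -expr2 sqr_sqrtr// => ->.
  by rewrite mulrACA.
apply: (@le_trans _ _ ((rk U t)%:R * (Num.sqrt Pl * Num.sqrt Pr) * sg)).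
  rewrite key -[leRHS]mulrA; apply: ler_wpM2l => //; exact: sqrtr_ge0.
rewrite -[(k t)%:R * _ * _]mulrA; apply: ler_wpM2r => //.
apply: ler_wpM2r; first by rewrite mulr_ge0 ?sqrtr_ge0.
by rewrite ler_nat.
Qed.

(** * Choice of the constants and conclusion *)

Lemma card_multi_index (d : nat) (n : 'I_d -> nat) :
  #|multi_index n| = (\prod_(s < d) n s)%N.
Proof.
rewrite card_dep_ffun foldrE big_map big_enum /=.
by apply: eq_bigr => s _; rewrite card_ord.
Qed.

(** With x = 2 e N the constant 64 makes the exponential at most x^-2, and x >= 4 N gives 8 N / x^2
    <= 1 / (2 N) < 1. *)
Lemma union_bound_size (R : realType) (N r : nat) (delta c : R) :
  (0 < N)%N -> 0 < delta -> c = 64 / delta ^+ 2 ->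
  c * ln (2 * expR 1 * N%:R) <= r%:R ->
  8 * N%:R * expR (- (r%:R * delta ^+ 2 / 32)) < 1.
Proof.
move=> N0 d0 -> hr; set x := 2 * expR 1 * N%:R in hr.
have N1 : 1 <= N%:R :> R by rewrite ler1n.
have e2 : 2 <= expR 1 :> R by have := expR_ge1Dx (1 : R); lra.
have x0 : 0 < x by rewrite !mulr_gt0 ?expR_gt0// (lt_le_trans ltr01).
have d2 : 0 < delta ^+ 2 by rewrite exprn_gt0.
have h : 2 * ln x <= r%:R * delta ^+ 2 / 32.
  move: hr; rewrite mulrAC ler_pdivrMr// => hr; lra.
apply: (@le_lt_trans _ _ (8 * N%:R * expR (- (2 * ln x)))).
  by rewrite ler_wpM2l ?mulr_ge0// ler_expR lerN2.
rewrite expRN expRM_natl lnK ?posrE// ltr_pdivrMr ?exprn_gt0// mul1r.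
have : 4 * N%:R <= x by rewrite /x; nra.
move: x0 => _; nra.
Qed.

Theorem corollary3p6 (R : realType) (d : nat) (hd : (2 <= d)%N) :
  exists c : R, 0 < c /\
    forall (eps : R) (n : 'I_d -> nat) (r : nat),
      0 < eps < 1 ->
      (forall s, (0 < n s)%N) ->
      r%:Z = Num.ceil (c / eps ^+ 2 *
               ln (2 * expR 1 * \prod_(s < d) (n s)%:R)) ->
      forall (A : tensor R n) (k : nat -> nat),
        A != 0 -> is_tt_rank A k ->
        exists (B : tensor R n) (l : nat -> nat),
          [/\ is_tt_rank B l,
              forall s, (0 < s < d)%N -> (l s <= r)%N &
              max_norm (A - B) <=
                eps / Num.sqrt (\prod_(s < d) (n s)%:R) *
                \big[Num.min/tt_bound A k 1]_(1 <= t < d) tt_bound A k t].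
Proof.
pose K : R := 2 ^+ d; have K0 : 0 < K by rewrite exprn_gt0.
have K2 : 2 <= K.
  by rewrite /K -[leLHS]expr1 ler_eXn2l ?ltr1n// ltnW.
(* With delta = eps / 2^d this makes c / eps^2 equal to 64 / delta^2. *)
exists (64 * K ^+ 2); split=> [|eps n r /andP[e0 e1] n0 hr A k A0 rkA].
  by rewrite mulr_gt0// exprn_gt0.
set N : R := \prod_(s < d) (n s)%:R in hr *.
have EN : N = #|multi_index n|%:R by rewrite card_multi_index natr_prod.
have N0 : (0 < #|multi_index n|)%N by rewrite card_multi_index prodn_gt0.
have N1 : 0 < N by rewrite EN ltr0n.
pose delta := eps / K.
have d0 : 0 < delta by rewrite divr_gt0.
have hr' : 64 / delta ^+ 2 * ln (2 * expR 1 * N) <= r%:R.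
  have -> : 64 / delta ^+ 2 = 64 * K ^+ 2 / eps ^+ 2.
    by rewrite /delta; field; rewrite !gt_eqF.
  have := ceil_ge (64 * K ^+ 2 / eps ^+ 2 * ln (2 * expR 1 * N)).
  by rewrite -hr.
have dh : 0 < delta <= 1 / 2.
  rewrite d0 /= /delta ler_pdivrMr//; lra.
have small : 8 * #|multi_index n|%:R * expR (- (r%:R * delta ^+ 2 / 32)) < 1.
  by apply: union_bound_size N0 d0 erefl _; rewrite -EN.
have r0 : (0 < r)%N.
  rewrite -(ltr0n R); apply: lt_le_trans hr'; rewrite mulr_gt0//.
    by rewrite divr_gt0// exprn_gt0.
  rewrite ln_gt0//; have : 1 <= N by rewrite EN ler1n.
  have : 2 <= expR 1 :> R by have := expR_ge1Dx (1 : R); lra.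
  by nra.
(* The default value of the minimum belongs to t = 1, an admissible bond as d >= 2, so the minimum
   is attained and one t suffices. *)
have [t [td Emin]] : exists t, (0 < t < d)%N /\
    \big[Num.min/tt_bound A k 1]_(1 <= t < d) tt_bound A k t = tt_bound A k t.
  rewrite big_nat; apply: (big_ind (fun x => exists t, (0 < t < d)%N /\
    x = tt_bound A k t)) => [|x y [s [sd ->]] [u [ud ->]]|s sd].
  - by exists 1%N.
  - by case: (leP (tt_bound A k s) (tt_bound A k u)) => _; [exists s|exists u].
  - by exists s.
rewrite Emin.
have [H eH hH] := exists_tt_bound_factorization td A0 rkA.
have [U [rkU hU]] := tt_rank_reduction H r0 dh small.
have [l [[U' eU' rkU'] lmin]] := exists_tt_rank U (ltnW hd).
exists (TT U), l; split.
- by split=> //; exists U'.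
- by move=> s sd; rewrite -(rkU s sd); exact: lmin.
have sN : 0 < Num.sqrt N by rewrite sqrtr_gt0.
have bnd i : `|(A - TT U) i| <= eps / Num.sqrt N * tt_bound A k t.
  rewrite -eH; have -> : (TT H - TT U) i = TT H i - TT U i by rewrite !ffunE.
  apply: le_trans (hU i) _.
  have -> : 2 ^+ d * delta = eps by rewrite /delta mulrCA mulfV ?mulr1// gt_eqF.
  rewrite -mulrA ler_pM2l// mulrC ler_pdivlMr// mulrC eH; exact: hH.
apply/bigmax_leP; split=> [|i _]; last exact: bnd.
(* The default 0 of [max_norm] requires a nonnegative bound; the estimate at any one entry provides
   it. *)
have /card_gt0P[z _] := N0.
by apply: le_trans (bnd z).
Qed.
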